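(* Let $T\subset\mathbb{R}^3$ be a polyhedron and $k\ge0$ an integer. For the projection operators $Q_h^{(1)}$, $Q_h^{(2)}$ and the composite weak gradient $\nabla_w: V_k^{(1)}(T)\to V_k^{(2)}(T)$, $$\nabla_w(Q_h^{(1)}v)=Q_h^{(2)}\nabla v\qquad\forall v\in H^1(T)\cap C^1(T).$$
   Context: Geometry and notation. $T\subset\mathbb{R}^3$ is a (closed, bounded) polyhedron with flat polygonal faces, each edge being shared by exactly two faces; functions in $C(T)$, $C^1(T)$ are continuous (resp. continuously differentiable) on the closed region $T$. $F(T)$, $E(T)$, $V(T)$ are its sets of faces, edges and vertices. $P_j(D)$ is the space of polynomials of total degree at most $j$ on $D$. $(\cdot,\cdot)_D$ is the $L^2$ inner product on $D$ (volume, surface or curve; for the two end points $\partial e$ of an edge it is the sum of values at the end points). $\mathbf{n}$ is the unit outward normal on $\partial T$. For a face $f$, $\mathbf{n}_f$ is a fixed unit normal, $\mathbf{t}_{f,1},\mathbf{t}_{f,2}$ are orthogonal unit vectors tangential to $f$, and $\mathbf{t}_{\partial f}$ is the unit tangent on $\partial f$ oriented by the right-hand rule with respect to $\mathbf{n}_f$. For an edge $e$, $\mathbf{t}_e$ is a fixed unit tangent vector and $\mathbf{n}_{\partial e}$ is the unit outward direction (along the edge) at its two end points. Spaces. - $V_{k,0}^{(2)}(T)=[P_k(T)]^3$, $V_{k,f}^{(2)}(f)=\{u_1\mathbf{t}_{f,1}+u_2\mathbf{t}_{f,2}: u_1,u_2\in P_k(f)\}$, $V_{k,e}^{(2)}(e)=\{u\mathbf{t}_e: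 u\in P_k(e)\}$. - $V_k^{(1)}(T)=\{v=\{v_0,v_f,v_e,v_n\}: v_0\in P_k(T), v_f\in P_k(f), v_e\in P_k(e), v_n\in\mathbb{R}, f\in F(T), e\in E(T), n\in V(T)\}$. - $V_k^{(2)}(T)=\{\mathbf{u}=\{\mathbf{u}_0,\mathbf{u}_f,\mathbf{u}_e\}: \mathbf{u}_0\in V_{k,0}^{(2)}(T),\mathbf{u}_f\in V_{k,f}^{(2)}(f),\mathbf{u}_e\in V_{k,e}^{(2)}(e), f\in F(T), e\in E(T)\}$. Weak gradient. $\nabla_w v=\{\nabla_{w,0}v,\nabla_{w,f}v,\nabla_{w,e}v\}\in V_k^{(2)}(T)$ for $v\in V_k^{(1)}(T)$, with components determined by $$(\nabla_{w,0}v,\varphi)_T=-(v_0,\nabla\cdot\varphi)_T+(v_f,\varphi\cdot\mathbf{n})_{\partial T}\quad\forall\varphi\in V_{k,0}^{(2)}(T),$$ $$(\nabla_{w,f}v,\theta\times\mathbf{n}_f)_f=-(v_f,(\nabla\times\theta)\cdot\mathbf{n}_f)_f+(v_e,\theta\cdot\mathbf{t}_{\partial f})_{\partial f}\quad\forall\theta\in V_{k,f}^{(2)}(f),$$ $$(\nabla_{w,e}v,\varphi\mathbf{t}_e)_e=-(v_e,\nabla\varphi\cdot\mathbf{t}_e)_e+(v_n,\varphi\,\mathbf{t}_e\cdot\mathbf{n}_{\partial e})_{\partial e}\quad\forall\varphi\mathbf{t}_e\in V_{k,e}^{(2)}(e).$$ Projections. For $v\in H^1(T)\cap C(T)$, $Q_h^{(1)}v=\{Q_0^{(1)}v,\,Q_f^{(1)}(v|_f),\,Q_e^{(1)}(v|_e),\,v|_n\}\in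 V_k^{(1)}(T)$, where $Q_0^{(1)},Q_f^{(1)},Q_e^{(1)}$ are the $L^2$ projections onto $P_k(T),P_k(f),P_k(e)$ and $v|_n$ is the value at the vertex $n$. For $\mathbf{u}\in H(\mathrm{curl};T)\cap[C(T)]^3$, $Q_h^{(2)}\mathbf{u}=\{Q_0^{(2)}\mathbf{u},\,Q_f^{(2)}(\mathbf{n}_f\times(\mathbf{u}|_f\times\mathbf{n}_f)),\,Q_e^{(2)}((\mathbf{u}|_e\cdot\mathbf{t}_e)\mathbf{t}_e)\}\in V_k^{(2)}(T)$, where $Q_0^{(2)},Q_f^{(2)},Q_e^{(2)}$ are the $L^2$ projections onto $V_{k,0}^{(2)}(T),V_{k,f}^{(2)}(f),V_{k,e}^{(2)}(e)$. *)

(* Defs.v *)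
From HB Require Import structures.
From mathcomp Require Import all_boot all_order all_algebra.
From mathcomp Require Import all_classical all_reals all_analysis.

Set Implicit Arguments.
Unset Strict Implicit.
Unset Printing Implicit Defensive.

Import Order.TTheory GRing.Theory Num.Theory.
Import numFieldNormedType.Exports.

Local Open Scope classical_set_scope.
Local Open Scope ring_scope.

Section Euclid.
Variable R : realType.
Local Notation pt := 'rV[R]_3.

Definition vec3 (a b c : R) : pt := \row_(i < 3) [:: a; b; c]`_i.

Definition dot (u v : pt) : R := \sum_(i < 3) u 0 i * v 0 i.

Definition enorm (u : pt) : R := Num.sqrt (dot u u).

Definition cross (u v : pt) : pt :=
  vec3 (u 0 1 * v 0 2%:R - u 0 2%:R * v 0 1)
       (u 0 2%:R * v 0 0 - u 0 0 * v 0 2%:R)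
       (u 0 0 * v 0 1 - u 0 1 * v 0 0).

Definition pd (i : 'I_3) (g : pt -> R) (x : pt) : R :=
  'D_(delta_mx 0 i) (g : pt -> R^o) x.

Definition grad (g : pt -> R) (x : pt) : pt := \row_i pd i g x.

Definition div (u : pt -> pt) (x : pt) : R :=
  \sum_(i < 3) pd i (fun y => u y 0 i) x.

Definition curl (u : pt -> pt) (x : pt) : pt :=
  let d (i j : 'I_3) := pd i (fun y => u y 0 j) x in
  vec3 (d 1 2%:R - d 2%:R 1) (d 2%:R 0 - d 0 2%:R) (d 0 1 - d 1 0).

(* Gradient at x relative to D; unlike [grad], it makes sense at boundary
   points of a closed region D on which alone v is prescribed. *)
Definition has_gradient (D : set pt) (v : pt -> R) (x g : pt) : Prop :=
  forall eps : R, 0 < eps ->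
    \forall y \near within D (nbhs x),
      `|v y - v x - dot g (y - x)| <= eps * `|y - x|.

Definition gradient (D : set pt) (v : pt -> R) (x : pt) : pt :=
  get [set g | has_gradient D v x g].

Definition C1 (D : set pt) (v : pt -> R) : Prop :=
  (forall x, D x -> exists g, has_gradient D v x g) /\
  {within D, continuous (gradient D v)}.

Local Notation line := (measurableTypeR R).

Definition leb1 : {measure set line -> \bar R} := lebesgue_measure.

Definition leb2 : {measure set (line * line) -> \bar R} :=
  (@lebesgue_measure R \x @lebesgue_measure R)%E.

Definition leb3 : {measure set (line * line * line) -> \bar R} :=
  (@lebesgue_measure R \x @lebesgue_measure R \x @lebesgue_measure R)%E.

Definition pt_of (p : R * R * R) : pt := vec3 p.1.1 p.1.2 p.2.

Definition int_vol (D : set pt) (g : pt -> R) : R :=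
  \int[leb3]_(p in pt_of @^-1` D) g (pt_of p).

Definition L2 (D : set pt) (v : pt -> R) : Prop :=
  measurable_fun (pt_of @^-1` D) (v \o pt_of) /\
  leb3.-integrable (pt_of @^-1` D) (fun p => ((v (pt_of p)) ^+ 2)%:E).

Fixpoint Cn (n : nat) (g : pt -> R) : Prop :=
  continuous g /\
  if n is m.+1 then
    forall i : 'I_3,
      (forall x, derivable (g : pt -> R^o) x (delta_mx 0 i)) /\ Cn m (pd i g)
  else True.

Definition test_function (D : set pt) (phi : pt -> R) : Prop :=
  [/\ forall n, Cn n phi,
      compact (closure [set x | phi x != 0]) &
      closure [set x | phi x != 0] `<=` D].

(* Sobolev space H^1 of the interior of D *)
Definition H1 (D : set pt) (v : pt -> R) : Prop :=
  L2 D° v /\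
  exists g : pt -> pt, forall i : 'I_3,
    L2 D° (fun x => g x 0 i) /\
    forall phi, test_function D° phi ->
      int_vol D° (fun x => v x * pd i phi x) =
      - int_vol D° (fun x => g x 0 i * phi x).

(* Interior of A relative to the planes orthogonal to n; y = x gives A x *)
Definition relint (n : pt) (A : set pt) : set pt :=
  [set x : pt | \forall y \near x, dot n (y - x) = 0 -> A y].

Definition points_out (D : set pt) (n x : pt) : Prop :=
  \forall eps \near (0 : R)^'+, ~ D (x + eps *: n) /\ D (x - eps *: n).

Definition segment (a b : pt) : set pt :=
  [set a + s *: (b - a) | s in `[0, 1] : set R].

Definition open_segment (a b : pt) : set pt :=
  [set a + s *: (b - a) | s in `]0, 1[ : set R].

End Euclid.

(* [fnormal], [ftan1], [ftan2] are the fixed normal n_f and tangents t_{f,1},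
   t_{f,2}; the ordering of the end points of an edge is the (arbitrary) choice
   of the fixed tangent t_e.  [fout] is the outward normal n of the polyhedron
   on f and [conormal f e] is the outward normal of f along its edge e within
   the plane of f. *)
Record polyhedron (R : realType) := Polyhedron {
  region : set 'rV[R]_3 ;
  face : finType ;
  edge : finType ;
  vertex : finType ;
  vpos : vertex -> 'rV[R]_3 ;
  esrc : edge -> vertex ;
  etgt : edge -> vertex ;
  fset : face -> set 'rV[R]_3 ;
  fedges : face -> {set edge} ;
  forigin : face -> 'rV[R]_3 ;
  fnormal : face -> 'rV[R]_3 ;
  ftan1 : face -> 'rV[R]_3 ;
  ftan2 : face -> 'rV[R]_3 ;
  fout : face -> 'rV[R]_3 ;
  conormal : face -> edge -> 'rV[R]_3 ;
  (* the region *)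
  region_neq0 : region !=set0 ;
  region_closed : closed region ;
  region_bounded : bounded_set region ;
  region_regular : closure region° = region ;
  region_connected : connected region° ;
  region_boundary : region `\` region° = \bigcup_f fset f ;
  (* vertices and edges *)
  vpos_inj : injective vpos ;
  vertex_edge : forall n, exists e, n = esrc e \/ n = etgt e ;
  edge_nondegenerate : forall e, esrc e != etgt e ;
  edge_meet : forall e e', e != e' ->
    segment (vpos (esrc e)) (vpos (etgt e)) `&`
      segment (vpos (esrc e')) (vpos (etgt e'))
    `<=` [set vpos (esrc e); vpos (etgt e)] ;
  (* faces: flat polygons, each edge being shared by exactly two of them *)
  face_frame : forall f,
    [/\ dot (fnormal f) (fnormal f) = 1,
        dot (ftan1 f) (ftan1 f) = 1 & dot (ftan2 f) (ftan2 f) = 1] /\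
    [/\ dot (fnormal f) (ftan1 f) = 0,
        dot (fnormal f) (ftan2 f) = 0 & dot (ftan1 f) (ftan2 f) = 0] ;
  face_origin : forall f, fset f (forigin f) ;
  face_flat : forall f x, fset f x -> dot (fnormal f) (x - forigin f) = 0 ;
  face_regular : forall f, closure (relint (fnormal f) (fset f)) = fset f ;
  face_connected : forall f, connected (relint (fnormal f) (fset f)) ;
  face_boundary : forall f,
    fset f `\` relint (fnormal f) (fset f) =
    \bigcup_(e in [set` fedges f]) segment (vpos (esrc e)) (vpos (etgt e)) ;
  face_disjoint : forall f g, f != g ->
    relint (fnormal f) (fset f) `&` fset g = set0 ;
  edge_two_faces : forall e, #|[set f | e \in fedges f]| = 2%N ;
  (* outward normals *)
  fout_unit : forall f,
    [/\ dot (fout f) (fout f) = 1,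
        dot (fout f) (ftan1 f) = 0 & dot (fout f) (ftan2 f) = 0] ;
  fout_outward : forall f x,
    relint (fnormal f) (fset f) x -> points_out region (fout f) x ;
  conormal_unit : forall f e, e \in fedges f ->
    [/\ dot (conormal f e) (conormal f e) = 1,
        dot (conormal f e) (fnormal f) = 0 &
        dot (conormal f e) (vpos (etgt e) - vpos (esrc e)) = 0] ;
  conormal_outward : forall f e x, e \in fedges f ->
    open_segment (vpos (esrc e)) (vpos (etgt e)) x ->
    points_out (fset f) (conormal f e) x
}.

Section WeakGradient.
Variables (R : realType) (P : polyhedron R).
Local Notation pt := 'rV[R]_3.
Implicit Types (f : face P) (e : edge P) (n : vertex P).

Definition eset e : set pt := segment (vpos (esrc e)) (vpos (etgt e)).

Definition elen e : R := enorm (vpos (etgt e) - vpos (esrc e)).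

Definition etan e : pt := (elen e)^-1 *: (vpos (etgt e) - vpos (esrc e)).

(* t_{partial f} on e, by the right-hand rule with respect to n_f *)
Definition btan f e : pt := cross (fnormal f) (conormal f e).

Definition chart f (p : R * R) : pt :=
  forigin f + p.1 *: ftan1 f + p.2 *: ftan2 f.

Definition int_face f (g : pt -> R) : R :=
  \int[leb2 R]_(p in chart f @^-1` fset f) g (chart f p).

Definition int_edge e (g : pt -> R) : R :=
  \int[leb1 R]_(s in `[0, elen e]) g (vpos (esrc e) + s *: etan e).

(* Polynomials of total degree at most k are taken on the whole space; the
   spaces P_k(D), V_{k,0}(T), V_{k,f}(f) and V_{k,e}(e) consist of the
   restrictions to D of the members of [poly3], [vpoly], [fpoly] and [epoly]. *)
Definition poly3 (k : nat) : set (pt -> R) :=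
  [set p | exists c : {ffun 'I_3 -> 'I_k.+1} -> R,
     p = fun x : pt => \sum_(m : {ffun 'I_3 -> 'I_k.+1} | (\sum_i m i <= k)%N)
                     c m * \prod_i x 0 i ^+ m i].

Definition vpoly (k : nat) : set (pt -> pt) :=
  [set u | forall i, poly3 k (fun x => u x 0 i)].

Definition fpoly (k : nat) f : set (pt -> pt) :=
  [set u : pt -> pt | exists p1 p2, [/\ poly3 k p1, poly3 k p2 &
     u = fun x : pt => p1 x *: ftan1 f + p2 x *: ftan2 f]].

Definition epoly (k : nat) e : set (pt -> pt) :=
  [set (fun x => p x *: etan e) | p in poly3 k].

Definition restrictions {W : pointedType} (D : set pt) (V : set (pt -> W)) :
  set (pt -> W) := [set p \_ D | p in V].

(* Members of V_k^(1) and V_k^(2) have components vanishing off the region, face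
   or edge on which they live, so that Leibniz equality of records is equality
   in these spaces. *)
Record composite1 := Composite1 {
  c1_vol : pt -> R ;
  c1_face : face P -> pt -> R ;
  c1_edge : edge P -> pt -> R ;
  c1_vertex : vertex P -> R
}.

Record composite2 := Composite2 {
  c2_vol : pt -> pt ;
  c2_face : face P -> pt -> pt ;
  c2_edge : edge P -> pt -> pt
}.

Definition V1 (k : nat) : set composite1 := [set v |
  [/\ restrictions (region P) (poly3 k) (c1_vol v),
      forall f, restrictions (fset f) (poly3 k) (c1_face v f) &
      forall e, restrictions (eset e) (poly3 k) (c1_edge v e)]].

Definition V2 (k : nat) : set composite2 := [set u |
  [/\ restrictions (region P) (vpoly k) (c2_vol u),
      forall f, restrictions (fset f) (fpoly k f) (c2_face u f) &
      forall e, restrictions (eset e) (epoly k e) (c2_edge u e)]].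

(* L^2 projection of u onto the restrictions to D of the members of V, where
   [integ] is integration over D *)
Definition proj (integ : (pt -> R) -> R) (D : set pt) (V : set (pt -> R))
    (u : pt -> R) : pt -> R :=
  get [set q | restrictions D V q /\
    forall phi, V phi -> integ (fun x => q x * phi x) =
                           integ (fun x => u x * phi x)].

Definition vproj (integ : (pt -> R) -> R) (D : set pt) (V : set (pt -> pt))
    (u : pt -> pt) : pt -> pt :=
  get [set q | restrictions D V q /\
    forall phi, V phi -> integ (fun x => dot (q x) (phi x)) =
                           integ (fun x => dot (u x) (phi x))].

Definition Qh1 (k : nat) (v : pt -> R) : composite1 := {|
  c1_vol := proj (int_vol (region P)) (region P) (poly3 k) v ;
  c1_face f := proj (int_face f) (fset f) (poly3 k) v ;
  c1_edge e := proj (int_edge e) (eset e) (poly3 k) v ;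
  c1_vertex n := v (vpos n)
|}.

Definition Qh2 (k : nat) (u : pt -> pt) : composite2 := {|
  c2_vol := vproj (int_vol (region P)) (region P) (vpoly k) u ;
  c2_face f := vproj (int_face f) (fset f) (fpoly k f)
    (fun x => cross (fnormal f) (cross (u x) (fnormal f))) ;
  c2_edge e := vproj (int_edge e) (eset e) (epoly k e)
    (fun x => dot (u x) (etan e) *: etan e)
|}.

(* The derivatives of the test functions below are those of a polynomial
   extension off the face or edge, but only tangential ones enter (the normal
   component of the curl, the t_e component of the gradient), so that the
   choice of the extension is immaterial. *)
Definition weak_grad_vol_eq (k : nat) (v : composite1) (w : pt -> pt) : Prop :=
  forall phi, vpoly k phi ->
    int_vol (region P) (fun x => dot (w x) (phi x)) =
    - int_vol (region P) (fun x => c1_vol v x * div phi x)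
    + \sum_(f : face P)
        int_face f (fun x => c1_face v f x * dot (phi x) (fout f)).

Definition weak_grad_face_eq (k : nat) (v : composite1) f (w : pt -> pt) :
  Prop :=
  forall theta, fpoly k f theta ->
    int_face f (fun x => dot (w x) (cross (theta x) (fnormal f))) =
    - int_face f (fun x => c1_face v f x * dot (curl theta x) (fnormal f))
    + \sum_(e in fedges f)
        int_edge e (fun x => c1_edge v e x * dot (theta x) (btan f e)).

(* The outward direction n_{partial e} is t_e at the target of e and - t_e at
   its source. *)
Definition weak_grad_edge_eq (k : nat) (v : composite1) e (w : pt -> pt) :
  Prop :=
  forall phi, poly3 k phi ->
    int_edge e (fun x => dot (w x) (phi x *: etan e)) =
    - int_edge e (fun x => c1_edge v e x * dot (grad phi x) (etan e))
    + (c1_vertex v (etgt e) *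
         dot (phi (vpos (etgt e)) *: etan e) (etan e)
       + c1_vertex v (esrc e) *
         dot (phi (vpos (esrc e)) *: etan e) (- etan e)).

Definition weak_grad (k : nat) (v : composite1) : composite2 := {|
  c2_vol := get [set w | restrictions (region P) (vpoly k) w /\
                         weak_grad_vol_eq k v w] ;
  c2_face f := get [set w | restrictions (fset f) (fpoly k f) w /\
                            weak_grad_face_eq k v f w] ;
  c2_edge e := get [set w | restrictions (eset e) (epoly k e) w /\
                            weak_grad_edge_eq k v e w]
|}.

Lemma restrictions_point (W : pointedType) (D : set pt) (V : set (pt -> W))
    (Q : set (pt -> W)) :
  V (fun=> point) -> restrictions D V (get [set q | restrictions D V q /\ Q q]).
Proof.
move=> V0; case: (xgetP point) => [q _ [] //|_].
by exists (fun=> point) => //; apply/funext => x; rewrite /patch; case: ifP.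
Qed.

Lemma poly0 k : poly3 k (fun=> 0).
Proof.
by exists (fun=> 0); apply/funext => x; rewrite big1 // => m _; rewrite mul0r.
Qed.

Lemma vpoint0 : (point : pt) = 0.
Proof. by apply/rowP => i; rewrite !mxE. Qed.

Lemma vpoly0 k : vpoly k (fun=> point).
Proof.
move=> i; rewrite vpoint0 [X in poly3 k X](_ : _ = fun=> 0); first exact: poly0.
by apply/funext => x; rewrite mxE.
Qed.

Lemma fpoly0 k f : fpoly k f (fun=> point).
Proof.
exists (fun=> 0), (fun=> 0); split; [exact: poly0|exact: poly0|].
by apply/funext => x; rewrite vpoint0 !scale0r addr0.
Qed.

Lemma epoly0 k e : epoly k e (fun=> point).
Proof.
exists (fun=> 0); first exact: poly0.
by apply/funext => x; rewrite vpoint0 scale0r.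
Qed.

Lemma Qh1_V1 k v : V1 k (Qh1 k v).
Proof. by split=> *; apply/restrictions_point/poly0. Qed.

Lemma Qh2_V2 k u : V2 k (Qh2 k u).
Proof.
by split=> *; apply: restrictions_point;
  [exact: vpoly0|exact: fpoly0|exact: epoly0].
Qed.

Lemma weak_grad_V2 k v : V2 k (weak_grad k v).
Proof.
by split=> *; apply: restrictions_point;
  [exact: vpoly0|exact: fpoly0|exact: epoly0].
Qed.

End WeakGradient.

(* Main.v *)
Require Import Defs.
From HB Require Import structures.
From mathcomp Require Import all_boot all_order all_algebra.
From mathcomp Require Import all_classical all_reals all_analysis.
From mathcomp Require Import measurable_realfun.
From mathcomp Require Import ring lra.

(* All components of both sides are chosen by the same kind of [get], so it is
   enough to see that the conditions defining them are equivalent.  As the test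
   functions are polynomials, the projections can be dropped from the right-hand
   sides of the weak gradient equations, which then become Green's formulas for
   v on the region, on each face and on each edge.
   The formula on the region is proved one coordinate direction at a time.
   Almost every line in that direction avoids the edges and the faces parallel
   to it; it meets the boundary in finitely many points, at each of which the
   normal tells on which side the region lies, so the fundamental theorem of
   calculus applies to the section.  By Fubini it remains to integrate over the
   transverse plane, and each face contributes its integral times the cosine
   between its normal and the direction.  Slicing a face in its two tangent
   directions gives the formula on faces, applied to theta x n_f. *)

Set Implicit Arguments.
Unset Strict Implicit.
Unset Printing Implicit Defensive.

Import Order.TTheory GRing.Theory Num.Theory.
Import numFieldNormedType.Exports.

Local Open Scope classical_set_scope.
Local Open Scope ring_scope.

(** * Linear changes of variables *)

(** The orthogonality relations of the projections in [Qh1] can be used only once the projections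
    are known to exist, since [get] otherwise falls back on a default value. Monomials in three
    variables become linearly dependent on a face or an edge, so existence is obtained from the
    consistency of the normal equations and not from a basis. A line may meet the region in many
    intervals, and nothing orders its crossings with the boundary. The formula on a line is
    therefore proved for an arbitrary compact set of reals whose boundary points carry signs. Which
    faces are crossed depends on the line, whereas the integration over the transverse plane wants
    one fixed sum over all faces; extending the integrand by zero off each face provides it. Since
    [v] is prescribed on the closed region only, its derivatives along lines inside a face or an
    edge are read off from the gradient relative to the region. *)

Lemma pushforward_measure (R : realType) d1 d2 (X : measurableType d1)
    (Y : measurableType d2) (m : {measure set X -> \bar R}) (phi : X -> Y) :
  measurable_fun setT phi ->
  exists m' : {measure set Y -> \bar R}, forall S, m' S = m (phi @^-1` S).
Proof.
move=> mphi.
by exists (measure_function_pushforward__canonical__measure_function_Measure m mphi).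
Qed.

(** [\x] integrates the measures of x-sections and [\x^] those of y-sections; they agree on
    rectangles, hence everywhere by uniqueness. *)
Lemma product_measure_ysection (R : realType) d1 d2 (X : measurableType d1)
    (Y : measurableType d2) (m1 : {sigma_finite_measure set X -> \bar R})
    (m2 : {sigma_finite_measure set Y -> \bar R}) (A : set (X * Y)) :
  measurable A ->
  ((m1 \x m2) A = \int[m2]_y m1 (ysection A y))%E.
Proof.
move=> mA; transitivity ((m1 \x^ m2)%E A); last by [].
by apply: product_measure_unique => //= B C mB mC; rewrite product_measure2E.
Qed.

Section Scaling.
Context {R : realType}.
Local Open Scope ereal_scope.

(** The pushforward of [m1] under [phi] is [c] times [m2]; for an invertible linear map [c] is the
    inverse of the absolute determinant. Such factors multiply under composition, so linear maps can
    be treated by elimination. *)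
Definition scales d1 d2 (X : measurableType d1) (Y : measurableType d2)
    (m1 : {measure set X -> \bar R}) (phi : X -> Y)
    (m2 : {measure set Y -> \bar R}) (c : R) :=
  [/\ (0 < c)%R, measurable_fun setT phi &
      forall S, measurable S -> m1 (phi @^-1` S) = c%:E * m2 S].

Lemma scales_comp d1 d2 d3 (X : measurableType d1) (Y : measurableType d2)
    (Z : measurableType d3) (m1 : {measure set X -> \bar R})
    (m2 : {measure set Y -> \bar R}) (m3 : {measure set Z -> \bar R})
    (phi : X -> Y) (psi : Y -> Z) (c c' : R) :
  scales m1 phi m2 c -> scales m2 psi m3 c' ->
  scales m1 (psi \o phi) m3 (c * c').
Proof.
move=> [c0 mphi phiE] [c'0 mpsi psiE]; split.
- exact: mulr_gt0.
- exact: measurableT_comp.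
- move=> S mS; rewrite comp_preimage phiE; last first.
    by rewrite -[X in measurable X]setTI; exact: mpsi.
  by rewrite psiE// EFinM muleA.
Qed.

Section integral.
Context d1 d2 (X : measurableType d1) (Y : measurableType d2).
Variables (m1 : {measure set X -> \bar R}) (m2 : {measure set Y -> \bar R}).
Variables (phi : X -> Y) (c : R).
Hypothesis phiS : scales m1 phi m2 c.

Let c0 : (0 < c)%R. Proof. by case: phiS. Qed.
Let cnng : {nonneg R} := NngNum (ltW c0).
Let mphi : measurable_fun setT phi. Proof. by case: phiS. Qed.

Let pushE (S : set Y) : measurable S ->
  pushforward m1 phi S = mscale cnng m2 S.
Proof. by case: phiS => _ _ h mS; rewrite /pushforward h. Qed.

Lemma scales_integrable (f : Y -> \bar R) :
  m2.-integrable setT f -> m1.-integrable setT (f \o phi).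
Proof.
move=> /integrableP[mf foo]; apply/integrableP; split.
  exact: (measurableT_comp mf mphi).
have mabsf : measurable_fun setT (fun y => `|f y|) by exact: measurableT_comp.
rewrite (_ : \int[m1]_x _ = \int[pushforward m1 phi]_y `|f y|); last first.
  by rewrite ge0_integral_pushforward// preimage_setT.
rewrite (eq_measure_integral (mscale cnng m2)); last first.
  by move=> A mA _; exact: pushE.
rewrite ge0_integral_mscale//=.
by rewrite lte_mul_pinfty// ?lee_fin ?ltW.
Qed.

Lemma scales_integral (f : Y -> R) : m2.-integrable setT (EFin \o f) ->
  (\int[m1]_x f (phi x) = c * \int[m2]_y f y)%R.
Proof.
move=> intf.
have intfp := scales_integrable intf.
have mf : measurable_fun setT (EFin \o f) by case/integrableP : intf.
have E : \int[m1]_x (f (phi x))%:E = c%:E * \int[m2]_y (f y)%:E.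
  transitivity (\int[pushforward m1 phi]_y (f y)%:E).
    by rewrite (integral_pushforward mphi mf)// preimage_setT.
  transitivity (\int[mscale cnng m2]_y (f y)%:E).
    by apply: eq_measure_integral => A mA _; exact: pushE.
  rewrite [LHS]integralE [in RHS](integralE m2 setT (fun y => (f y)%:E)).
  rewrite !ge0_integral_mscale//.
  - by rewrite -muleBr ?integrable_add_def.
  - exact: measurable_funeneg.
  - exact: measurable_funepos.
rewrite /Rintegral E fineM//.
exact: integrable_fin_num.
Qed.

End integral.
End Scaling.

Section Lebesgue.
Context {R : realType}.
Local Notation line := (measurableTypeR R).

Lemma measurable_affine (a b : R) :
  measurable_fun setT ((fun x => a * x + b) : line -> line).
Proof.
by apply: measurable_funD => //; exact: measurable_funM.
Qed.

(** By uniqueness of Lebesgue measure it suffices that [|a|] times the pushforward gives each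
    interval []u, v]] its length; for negative [a] the preimage is closed on the left instead. *)
Lemma leb1_affine (a b : R) : a != 0 ->
  scales (leb1 R) (fun x : line => a * x + b : line) (leb1 R) `|a|^-1.
Proof.
move=> a0; have na0 : 0 < `|a| by rewrite normr_gt0.
pose phi := fun x : line => a * x + b : line.
have mphi : measurable_fun setT phi := measurable_affine a b.
split; [by rewrite invr_gt0|exact: mphi|move=> S mS].
pose cn : {nonneg R} := NngNum (ltW na0).
have [m' m'E] := pushforward_measure (leb1 R) mphi.
have E : @lebesgue_measure R S = mscale cn m' S.
  apply: lebesgue_measure_unique mS => //= _ [[u v] _ <-].
  rewrite /mscale m'E /leb1 /= lebesgue_measure_itv /=.
  have [agt|alt|/eqP] := ltgtP a 0; last by rewrite (negPf a0).
  - rewrite (_ : phi @^-1` _ = `[(v - b) / a, (u - b) / a[%classic); last first.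
      apply/seteqP; split => x /=; rewrite !in_itv/= /phi.
        by rewrite ler_ndivrMr// ltr_ndivlMr// => /andP[]; lra.
      by rewrite ler_ndivrMr// ltr_ndivlMr// => /andP[]; lra.
    rewrite lebesgue_measure_itv /= !lte_fin.
    rewrite ltr_nM2r ?invr_lt0// ltrD2r.
    case: ifP => uv; last by rewrite mule0.
    rewrite -EFinD -!EFinD -EFinM; congr EFin.
    by rewrite ltr0_norm//; field.
  - rewrite (_ : phi @^-1` _ = `](u - b) / a, (v - b) / a]%classic); last first.
      apply/seteqP; split => x /=; rewrite !in_itv/= /phi.
        by rewrite ler_pdivlMr// ltr_pdivrMr// => /andP[]; lra.
      by rewrite ler_pdivlMr// ltr_pdivrMr// => /andP[]; lra.
    rewrite lebesgue_measure_itv /= !lte_fin.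
    rewrite ltr_pM2r ?invr_gt0// ltrD2r.
    case: ifP => uv; last by rewrite mule0.
    rewrite -EFinD -!EFinD -EFinM; congr EFin.
    by rewrite gtr0_norm//; field.
rewrite [leb1 R S]E /mscale /= m'E muleA -EFinM mulVf ?gt_eqF//.
by rewrite mul1e.
Qed.

Local Open Scope ereal_scope.
Local Notation plane := (line * line)%type.

Lemma leb2_ysection (S : set plane) : measurable S ->
  leb2 R S = \int[leb1 R]_y leb1 R (ysection S y).
Proof. exact: product_measure_ysection. Qed.

Lemma leb2_setX (A B : set line) : measurable A -> measurable B ->
  leb2 R (A `*` B) = leb1 R A * leb1 R B.
Proof. exact: product_measure1E. Qed.

Let leb2_sigma_finite : sigma_finite setT (leb2 R).
Proof.
have /sigma_finiteP[F [TF ndF Foo]] := sigma_finiteT (@lebesgue_measure R).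
exists (fun n => F n `*` F n).
  rewrite -setXTT TF predeqE => -[x y]; split.
    move=> [/= [n _ Fnx] [k _ Gky]]; exists (maxn n k) => //; split.
    - by move: x Fnx; exact/subsetPset/ndF/leq_maxl.
    - by move: y Gky; exact/subsetPset/ndF/leq_maxr.
  by move=> [n _ []/= ? ?]; split; exists n.
move=> k; have [? ?] := Foo k.
split; first exact: measurableX.
by rewrite leb2_setX// lte_mul_pinfty// ge0_fin_numE.
Qed.

(* The library makes products sigma-finite for probability measures only. *)
Definition leb2s : {sigma_finite_measure set plane -> \bar R} :=
  HB.pack_for {sigma_finite_measure set plane -> \bar R} (Measure.sort (leb2 R))
    (Measure_isSigmaFinite.Build _ _ _ (Measure.sort (leb2 R)) leb2_sigma_finite).

Lemma leb3_ysection (S : set (plane * line)) : measurable S ->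
  leb3 R S = \int[leb1 R]_y leb2 R (ysection S y).
Proof.
move=> mS.
have H := (@product_measure_ysection R _ _ _ _
   leb2s (@lebesgue_measure R) S mS).
exact: H.
Qed.
Lemma leb3_setX (A : set plane) (B : set line) : measurable A -> measurable B ->
  leb3 R (A `*` B) = leb2 R A * leb1 R B.
Proof.
move=> mA mB.
have H := (@product_measure1E _ _ _ _ R leb2s (@lebesgue_measure R) A B mA mB). 
exact: H.
Qed.

Let measurable_leb1_ysection (S : set plane) : measurable S ->
  measurable_fun setT (fun y : line => leb1 R (ysection S y)).
Proof.
by move=> mS; have := @measurable_fun_ysection _ _ _ _ R (@lebesgue_measure R) S mS.
Qed.

(** On the section at height y this is the affine map x -> a x + b y, whose factor does not depend
    on y. *)
Lemma leb2_shear1 (a b : R) : a != 0%R ->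
  scales (leb2 R) (fun p : plane => ((a * p.1 + b * p.2)%R, p.2) : plane)
    (leb2 R) `|a|^-1.
Proof.
move=> a0.
have mphi : measurable_fun setT
    (fun p : plane => ((a * p.1 + b * p.2)%R, p.2) : plane).
  apply: measurable_fun_pair => //=.
  apply: measurable_funD; apply: measurable_funM => //.
split => //; first by rewrite invr_gt0 normr_gt0.
move=> S mS.
have mS' : measurable ((fun p : plane => ((a * p.1 + b * p.2)%R, p.2) : plane) @^-1` S).
  by rewrite -[X in measurable X]setTI; exact: mphi.
rewrite !leb2_ysection//.
rewrite -ge0_integralZl//; last exact: measurable_leb1_ysection.
apply: eq_integral => y _.
have [_ _ <-] := leb1_affine (b * y) a0; last exact: measurable_ysection.
by congr (lebesgue_measure _); rewrite /ysection; apply/seteqP; split => x /=;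
  rewrite !inE.
Qed.

Definition pswap (p : plane) : plane := (p.2, p.1).

Lemma leb2_swap : scales (leb2 R) pswap (leb2 R) 1.
Proof.
have mphi : measurable_fun setT pswap by exact: measurable_fun_pair.
split => // S mS; rewrite mul1e.
have [m' m'E] := pushforward_measure (leb2 R) mphi.
rewrite -m'E; apply/esym/product_measure_unique => //.
move=> A B mA mB; rewrite m'E (_ : _ @^-1` _ = B `*` A).
  by rewrite leb2_setX// muleC.
by apply/seteqP; split => -[x y] /= [].
Qed.

Lemma leb2_linear (a b c d : R) : (a * d - b * c != 0)%R ->
  scales (leb2 R)
    (fun p : plane => ((a * p.1 + b * p.2)%R, (c * p.1 + d * p.2)%R) : plane)
    (leb2 R) `|(a * d - b * c)|%R^-1.
Proof.
(* If [a] is 0 then [c] is not, and exchanging the two output coordinates makes [c] the pivot. *)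
wlog a0 : a b c d / a != 0%R.
  move=> H D; have [a0|] := eqVneq a 0%R; last by move=> a0; exact: H.
  have c0 : c != 0%R by apply: contraNneq D => ->; rewrite a0 mulr0 mul0r subrr.
  have D' : (c * b - d * a != 0)%R.
    by rewrite -oppr_eq0 opprB mulrC (mulrC c).
  have := scales_comp (H c d a b c0 D') leb2_swap.
  by rewrite mulr1 -normrN opprB (mulrC c) (mulrC d).
move=> D.
(* Gaussian elimination: [e] is the second pivot, and the map is a composition of two shears and two
   swaps with factors [a] and [e]. *)
pose e := ((a * d - b * c) / a)%R.
have e0 : e != 0%R by rewrite mulf_neq0// invr_eq0.
have := scales_comp (scales_comp (scales_comp (leb2_shear1 b a0) leb2_swap)
  (leb2_shear1 (c / a) e0)) leb2_swap.
rewrite !mulr1 -invfM -normrM (_ : a * e = a * d - b * c)%R; last first.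
  by rewrite /e; field.
rewrite (_ : _ \o _ = (fun p : plane => ((a * p.1 + b * p.2)%R, (c * p.1 + d * p.2)%R) : plane))//.
apply/funext => -[x y] /=; rewrite /pswap/= /e; congr pair.
by field.
Qed.

Local Notation space := (plane * line)%type.

Lemma leb3_swap12 :
  scales (leb3 R) (fun p : space => (pswap p.1, p.2) : space) (leb3 R) 1.
Proof.
have mswap : measurable_fun setT pswap by case: leb2_swap.
have mphi : measurable_fun setT (fun p : space => (pswap p.1, p.2) : space).
  by apply: measurable_fun_pair => //=; exact: measurableT_comp.
split => // S mS; rewrite mul1e.
have [m' m'E] := pushforward_measure (leb3 R) mphi.
rewrite -m'E; apply/esym.
apply: (@product_measure_unique _ _ _ _ _ leb2s (@lebesgue_measure R) m' _ S mS).
move=> A B mA mB; rewrite m'E (_ : _ @^-1` _ = (pswap @^-1` A) `*` B).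
  rewrite leb3_setX//.
    by have [_ _] := leb2_swap => ->//; rewrite mul1e.
  by rewrite -[X in measurable X]setTI; exact: mswap.
by apply/seteqP; split => -[x y] /= [].
Qed.

(** Uniqueness is tested on [A] times [B] with [A] an arbitrary measurable set of the plane. The
    section of the preimage at z is [ysection A z] times [B], and integrating over z gives back the
    measure of [A]. *)
Lemma leb3_swap23 :
  scales (leb3 R) (fun p : space => ((p.1.1, p.2), p.1.2) : space) (leb3 R) 1.
Proof.
set phi := fun p : space => _.
have mphi : measurable_fun setT phi.
  apply: measurable_fun_pair => //=; last exact: measurableT_comp.
  by apply: measurable_fun_pair => //=; exact: measurableT_comp.
split => // S mS; rewrite mul1e.
have [m' m'E] := pushforward_measure (leb3 R) mphi.
rewrite -m'E; apply/esym.
apply: (@product_measure_unique _ _ _ _ _ leb2s (@lebesgue_measure R) m' _ S mS).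
move=> A B mA mB; rewrite m'E.
have mphiAB : measurable (phi @^-1` (A `*` B)).
  rewrite -[X in measurable X]setTI; apply: mphi => //.
  exact: measurableX.
rewrite leb3_ysection//.
have sE z : ysection (phi @^-1` (A `*` B)) z = ysection A z `*` B.
  apply/seteqP; split => -[x y]; rewrite /ysection /= !inE /phi/= ?inE//.
under eq_integral => z _.
  rewrite /= sE.
  rewrite leb2_setX//; last exact: measurable_ysection.
  rewrite muleC.
  over.
rewrite ge0_integralZl//; last exact: measurable_leb1_ysection.
rewrite muleC; congr (_ * _).
by rewrite leb2_ysection.
Qed.

End Lebesgue.

(** * Measurability and integrability of continuous functions *)

(** Fubini's theorem with inner integrals known only off a null set [N], which will consist of the
    bad lines. A further null set, where the sections are not integrable, is discarded in the
    proof. *)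
Lemma Rintegral_prod (R : realType) d1 d2 (X : measurableType d1)
    (Y : measurableType d2) (m1 : {sigma_finite_measure set X -> \bar R})
    (m2 : {sigma_finite_measure set Y -> \bar R}) (f : X * Y -> R)
    (g : X -> R) (N : set X) :
  (m1 \x m2)%E.-integrable setT (EFin \o f) ->
  measurable_fun setT g -> measurable N -> m1 N = 0%E ->
  (forall x, ~ N x -> \int[m2]_y f (x, y) = g x) ->
  \int[(m1 \x m2)%E]_z f z = \int[m1]_x g x.
Proof.
move=> intf mg mN N0 fg.
rewrite /Rintegral; congr fine.
rewrite -(integral12_prod_meas1 intf).
apply: ae_eq_integral => //.
- exact: (measurable_fubini_F intf).
- exact/measurable_EFinP.
have : {ae m1, forall x, ~ N x}.
  by exists N; split => // x /= /contrapT.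
have := ae_integrable1 intf.
apply: filterS2 => x intfx Nx _.
rewrite /fubini_F -(fg x Nx) /Rintegral fineK//.
exact: integrable_fin_num.
Qed.

(* [h] is the identity from a measurable type to the same type seen as a
   topological space; products carry both structures, but the library does not
   relate them. *)
Definition measurable_base d (T : measurableType d) (TT : topologicalType)
    (h : T -> TT) :=
  exists B : nat -> set TT, (forall i, measurable (h @^-1` B i)) /\
    forall U x, nbhs x U -> exists i, B i x /\ B i `<=` U.

Lemma measurable_base_open d (T : measurableType d) (TT : topologicalType)
    (h : T -> TT) (U : set TT) :
  measurable_base h -> open U -> measurable (h @^-1` U).
Proof.
move=> [B [mB BU]] oU.
rewrite (_ : h @^-1` U = \bigcup_(i in [set i | B i `<=` U]) (h @^-1` B i)).
  by apply: bigcup_measurable => i _; exact: mB.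
apply/seteqP; split => [x Ux|x [i BiU /BiU//]].
have [i [Bix BiU]] : exists i, B i (h x) /\ B i `<=` U.
  by apply: BU; exact: open_nbhs_nbhs.
by exists i.
Qed.

Lemma measurable_base_closed d (T : measurableType d) (TT : topologicalType)
    (h : T -> TT) (U : set TT) :
  measurable_base h -> closed U -> measurable (h @^-1` U).
Proof.
move=> hB cU; rewrite -(setCK U) preimage_setC; apply: measurableC.
exact: (measurable_base_open hB (closed_openC cU)).
Qed.

Lemma measurable_base_R (R : realType) :
  measurable_base (fun x : measurableTypeR R => x : R).
Proof.
pose B (p : option (rat * rat)) : set R :=
  if p is Some q then `]ratr q.1, ratr q.2[%classic else set0.
exists (fun i => B (unpickle i)); split.
  move=> i; case: (unpickle i) => [q|] /=; last by rewrite preimage_set0.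
  exact: (measurable_itv `]ratr q.1, ratr q.2[).
move=> U x /nbhs_ballP[e /= e0 eU].
have /rat_in_itvoo[q1] : x - e < x by rewrite ltrBlDr ltrDl.
rewrite in_itv/= => /andP[q1l q1r].
have /rat_in_itvoo[q2] : x < x + e by rewrite ltrDl.
rewrite in_itv/= => /andP[q2l q2r].
exists (pickle (q1, q2)); rewrite pickleK /=; split.
  by rewrite /= in_itv/= q1r.
move=> y /=; rewrite in_itv/= => /andP[y1 y2]; apply: eU.
rewrite /ball/= ltr_distlC; apply/andP; split; first exact: lt_trans y1.
exact: lt_trans q2r.
Qed.

Lemma measurable_base_prod d1 d2 (T1 : measurableType d1)
    (T2 : measurableType d2) (TT1 TT2 : topologicalType)
    (h1 : T1 -> TT1) (h2 : T2 -> TT2) :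
  measurable_base h1 -> measurable_base h2 ->
  measurable_base (fun p : T1 * T2 => (h1 p.1, h2 p.2) : TT1 * TT2).
Proof.
move=> [B1 [mB1 B1U]] [B2 [mB2 B2U]].
pose B (p : option (nat * nat)) : set (TT1 * TT2) :=
  if p is Some q then B1 q.1 `*` B2 q.2 else set0.
exists (fun i => B (unpickle i)); split.
  move=> i; case: (unpickle i) => [q|] /=; last by rewrite preimage_set0.
  by rewrite (_ : _ @^-1` _ = (h1 @^-1` B1 q.1) `*` (h2 @^-1` B2 q.2))//;
    exact: measurableX.
move=> U [x y] [[A1 A2] /= [n1 n2] AU].
have [i1 [Bi1 sB1]] := B1U _ _ n1.
have [i2 [Bi2 sB2]] := B2U _ _ n2.
exists (pickle (i1, i2)); rewrite pickleK /=; split => //.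
by move=> [a b] /= [/sB1 ? /sB2 ?]; exact: AU.
Qed.

(** The preimage of an open interval is relatively open in the closed [D], hence the trace on [D] of
    an open set, and both sets have measurable preimages. *)
Lemma within_continuous_measurable (R : realType) d (T : measurableType d)
    (TT : topologicalType) (h : T -> TT) (W : topologicalType) (gam : TT -> W)
    (D : set W) (f : W -> R) :
  measurable_base h -> continuous gam -> closed D ->
  {within D, continuous f} ->
  measurable_fun (h @^-1` (gam @^-1` D)) (f \o gam \o h).
Proof.
move=> hB cg cD /continuousP cf.
have mD : measurable (h @^-1` (gam @^-1` D)).
  apply: (measurable_base_closed hB); apply: preimage_closed cD => x _; exact: cg.
apply: (measurability _ (RGenOpens.measurableE R)) => //.
move=> _ [_ [a [b ->] <-]].
have /open_subspaceP[V oV VD] := cf `]a, b[%classic (@interval_open _ (BRight a) (BLeft b) isT isT).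
rewrite (_ : _ `&` _ = h @^-1` (gam @^-1` D) `&` h @^-1` (gam @^-1` V)).
  apply: measurableI => //; apply: (measurable_base_open hB).
  by apply: open_comp oV => x _; exact: cg.
apply/seteqP; split => x [Dx /= ?]; split => //.
  have : (f @^-1` `]a, b[ `&` D) (gam (h x)) by [].
  by rewrite -VD => -[].
have : (V `&` D) (gam (h x)) by [].
by rewrite VD => -[].
Qed.

(** * The dot product and coordinates *)

Section Dot.
Context {R : realType}.
Local Notation pt := 'rV[R]_3.
Implicit Types u v w : pt.

Lemma dotE u v : dot u v = u 0 0 * v 0 0 + u 0 1 * v 0 1 + u 0 2%:R * v 0 2%:R.
Proof.
rewrite /dot !big_ord_recl big_ord0 addr0 addrA.
by congr (_ + _ + _); congr (u _ _ * v _ _); apply/val_inj.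
Qed.

Lemma dotC u v : dot u v = dot v u.
Proof. by apply: eq_bigr => i _; rewrite mulrC. Qed.

Lemma dotDl u v w : dot (u + v) w = dot u w + dot v w.
Proof. by rewrite /dot -big_split; apply: eq_bigr => i _; rewrite mxE mulrDl. Qed.

Lemma dotZl a u v : dot (a *: u) v = a * dot u v.
Proof. by rewrite /dot mulr_sumr; apply: eq_bigr => i _; rewrite mxE mulrA. Qed.

Lemma dotNl u v : dot (- u) v = - dot u v.
Proof. by rewrite -scaleN1r dotZl mulN1r. Qed.

Lemma dotBl u v w : dot (u - v) w = dot u w - dot v w.
Proof. by rewrite dotDl dotNl. Qed.

Lemma dot0l u : dot 0 u = 0.
Proof. by rewrite -(scale0r u) dotZl mul0r. Qed.

Lemma dotDr u v w : dot w (u + v) = dot w u + dot w v.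
Proof. by rewrite dotC dotDl !(dotC w). Qed.

Lemma dotZr a u v : dot v (a *: u) = a * dot v u.
Proof. by rewrite dotC dotZl dotC. Qed.

Lemma dotNr u v : dot v (- u) = - dot v u.
Proof. by rewrite dotC dotNl dotC. Qed.

Lemma dotBr u v w : dot w (u - v) = dot w u - dot w v.
Proof. by rewrite dotDr dotNr. Qed.

Lemma dot_ge0 u : 0 <= dot u u.
Proof. by apply: sumr_ge0 => i _; rewrite -expr2 sqr_ge0. Qed.

Lemma dot_eq0 u : (dot u u == 0) = (u == 0).
Proof.
apply/idP/eqP => [|->]; last by rewrite dot0l.
rewrite psumr_eq0 => [/allP h|i _]; last by rewrite -expr2 sqr_ge0.
apply/rowP => i; have := h i (mem_index_enum _).
by rewrite mulf_eq0 orbb mxE => /eqP.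
Qed.

Lemma coord_norm_le u i : `|u 0 i| <= `|u|.
Proof.
rewrite [leRHS]mx_normrE.
exact: (le_trans _ (le_bigmax _ (fun j : 'I_1 * 'I_3 => `|u j.1 j.2|) (0, i))).
Qed.

(** The norm of [pt] is the maximum norm, whence the factor 3. *)
Lemma dot_norm_le u v : `|dot u v| <= 3 * `|u| * `|v|.
Proof.
have h i : `|u 0 i * v 0 i| <= `|u| * `|v|.
  by rewrite normrM; apply: ler_pM => //; exact: coord_norm_le.
rewrite dotE (_ : 3 * `|u| * `|v| = `|u| * `|v| + `|u| * `|v| + `|u| * `|v|); last by ring.
apply: (le_trans (ler_normD _ _)); apply: lerD; last exact: h.
by apply: (le_trans (ler_normD _ _)); apply: lerD; exact: h.
Qed.

Lemma continuous_coord i : continuous (fun u : pt => u 0 i).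
Proof. exact: coord_continuous. Qed.

Lemma continuous_dotr u : continuous (dot u).
Proof.
move=> x; rewrite (_ : dot u = fun y => u 0 0 * y 0 0 + u 0 1 * y 0 1 + u 0 2%:R * y 0 2%:R).
  have c i : (fun y : pt => u 0 i * y 0 i) @ x --> u 0 i * x 0 i.
    exact: (cvgM (cvg_cst _) (@continuous_coord i x)).
  exact: (cvgD (cvgD (c 0) (c 1)) (c 2%:R)).
by apply/funext => y; rewrite dotE.
Qed.

Lemma vec30 (a b c : R) : vec3 a b c 0 0 = a. Proof. by rewrite mxE. Qed.
Lemma vec31 (a b c : R) : vec3 a b c 0 1 = b. Proof. by rewrite mxE. Qed.
Lemma vec32 (a b c : R) : vec3 a b c 0 2%:R = c. Proof. by rewrite mxE. Qed.

Lemma pt_ext u v : u 0 0 = v 0 0 -> u 0 1 = v 0 1 -> u 0 2%:R = v 0 2%:R -> u = v.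
Proof.
move=> h0 h1 h2; apply/rowP => -[[|[|[|//]]] hi].
- by rewrite (_ : Ordinal hi = 0) //; exact/val_inj.
- by rewrite (_ : Ordinal hi = 1) //; exact/val_inj.
- by rewrite (_ : Ordinal hi = 2%:R) //; exact/val_inj.
Qed.

Lemma vec3_scale (a b c : R) : vec3 a b c =
  a *: delta_mx 0 0 + b *: delta_mx 0 1 + c *: delta_mx 0 2%:R.
Proof. by apply: pt_ext; rewrite !mxE /=; ring. Qed.

End Dot.

(** * Continuous functions on a subset and their integrals *)

Section Continuity.
Context {R : realType}.
Local Notation pt := 'rV[R]_3.

Lemma within_continuousD (T : topologicalType) (D : set T) (f g : T -> R) :
  {within D, continuous f} -> {within D, continuous g} ->
  {within D, continuous (fun x => f x + g x)}.
Proof. by move=> cf cg x; apply: cvgD; [exact: cf|exact: cg]. Qed.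

Lemma within_continuousM (T : topologicalType) (D : set T) (f g : T -> R) :
  {within D, continuous f} -> {within D, continuous g} ->
  {within D, continuous (fun x => f x * g x)}.
Proof. by move=> cf cg x; apply: cvgM; [exact: cf|exact: cg]. Qed.

Lemma within_continuous_comp (S T U : topologicalType) (A : set S) (D : set T)
    (gam : S -> T) (f : T -> U) :
  continuous gam -> (forall x, A x -> D (gam x)) ->
  {within D, continuous f} -> {within A, continuous (f \o gam)}.
Proof.
move=> cgam AD /continuousP cf; apply/continuousP => O /cf /open_subspaceP[V oV VD].
apply/open_subspaceP; exists (gam @^-1` V).
  by apply: open_comp oV => s _; exact: cgam.
apply/seteqP; split => s [Os As]; split => //.
  have : (V `&` D) (gam s) by split => //; exact: AD.
  by rewrite VD => -[].
have : (f @^-1` O `&` D) (gam s) by split => //; exact: AD.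
by rewrite -VD => -[].
Qed.

Lemma within_continuous_cst (T : topologicalType) (D : set T) (c : R) :
  {within D, continuous (fun _ => c)}.
Proof. by move=> x; exact: cvg_cst. Qed.

Lemma within_continuous_sum (T : topologicalType) (D : set T) (I : Type)
    (r : seq I) (P : pred I) (f : I -> T -> R) :
  (forall i, P i -> {within D, continuous (f i)}) ->
  {within D, continuous (fun x => \sum_(i <- r | P i) f i x)}.
Proof.
move=> cf; elim: r => [|i r IH].
  rewrite (_ : (fun _ => _) = fun _ => 0); first exact: within_continuous_cst.
  by apply/funext => x; rewrite big_nil.
have [Pi|Pi] := boolP (P i).
  rewrite (_ : (fun _ => _) = fun x => f i x + \sum_(j <- r | P j) f j x).
    by apply: within_continuousD => //; exact: cf.
  by apply/funext => x; rewrite big_cons Pi.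
rewrite (_ : (fun _ => _) = fun x => \sum_(j <- r | P j) f j x)//.
by apply/funext => x; rewrite big_cons (negPf Pi).
Qed.

Lemma within_continuous_compact_bounded (D : set pt) (f : pt -> R) :
  compact D -> {within D, continuous f} -> exists M, forall x, D x -> `|f x| <= M.
Proof.
move=> cD cf; have /compact_bounded[M [_ /(_ (M + 1))]] := continuous_compact cf cD.
rewrite ltrDl => /(_ ltr01) h; exists (M + 1) => x Dx; apply: h; exact: imageP.
Qed.

End Continuity.

(** The properties of integration shared by the region, the faces and the edges that existence of
    projections and Green's formulas rely on. Linearity is asked of continuous functions, which are
    integrable on the compact sets concerned. *)
Record integral_on (R : realType) (D : set 'rV[R]_3)
    (integ : ('rV[R]_3 -> R) -> R) : Prop := IntegralOn {
  integral_onD : forall f g : 'rV[R]_3 -> R, {within D, continuous f} ->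
    {within D, continuous g} ->
    integ (fun x => f x + g x) = integ f + integ g ;
  integral_onZ : forall (c : R) (f : 'rV[R]_3 -> R), {within D, continuous f} ->
    integ (fun x => c * f x) = c * integ f ;
  integral_on_ge0 : forall f : 'rV[R]_3 -> R, (forall x, D x -> 0 <= f x) -> 0 <= integ f ;
  eq_integral_on : forall f g : 'rV[R]_3 -> R, (forall x, D x -> f x = g x) -> integ f = integ g
}.

Section ParametrizedIntegral.
Context {R : realType} d (T : measurableType d) (TT : topologicalType).
Local Notation pt := 'rV[R]_3.
Variables (mu : {measure set T -> \bar R}) (h : T -> TT) (gam : TT -> pt).
Variable D : set pt.
Hypothesis hB : measurable_base h.
Hypothesis cgam : continuous gam.
Hypothesis compactD : compact D.
Hypothesis finD : (mu (h @^-1` (gam @^-1` D)) < +oo)%E.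

Let closedD : closed D.
Proof. by apply: compact_closed compactD; exact: norm_hausdorff. Qed.

Lemma measurable_param : measurable (h @^-1` (gam @^-1` D)).
Proof.
by apply: (measurable_base_closed hB); apply: preimage_closed closedD => x _;
  exact: cgam.
Qed.

Lemma integrable_param (f : pt -> R) : {within D, continuous f} ->
  mu.-integrable (h @^-1` (gam @^-1` D)) (EFin \o (f \o gam \o h)).
Proof.
move=> cf; have [M fM] := within_continuous_compact_bounded compactD cf.
apply: measurable_bounded_integrable => //.
- exact: measurable_param.
- exact: within_continuous_measurable.
- exists M; split; first exact: num_real.
  by move=> N MN x Dx; apply: le_trans (ltW MN); exact: fM.
Qed.

(** Extension by zero moves the integral to the whole parameter space, where changes of variables
    and Fubini's theorem are applied. *)
Lemma integrable_param_patch (f : pt -> R) : {within D, continuous f} ->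
  mu.-integrable setT (EFin \o ((f \_ D) \o gam \o h)).
Proof.
move=> cf; have := integrable_param cf.
rewrite (integrable_mkcond _ measurable_param).
rewrite (_ : _ \_ _ = EFin \o ((f \_ D) \o gam \o h))//.
apply/funext => x; rewrite /patch /=.
have -> : (x \in h @^-1` (gam @^-1` D)) = (gam (h x) \in D) by [].
by case: ifP.
Qed.

Lemma integral_on_param :
  integral_on D (fun g => \int[mu]_(p in h @^-1` (gam @^-1` D)) g (gam (h p))).
Proof.
have mD := measurable_param.
split.
- by move=> f g cf cg; rewrite RintegralD//; exact: integrable_param.
- by move=> c f cf; rewrite RintegralZl//; exact: integrable_param.
- by move=> f f0; apply: Rintegral_ge0 => x Dx; exact: f0.
- by move=> f g fg; apply: eq_Rintegral => x; rewrite inE => Dx; exact: fg.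
Qed.

End ParametrizedIntegral.

(** * The fundamental theorem of calculus on slices *)

Section LineFTC.
Context {R : realType}.
Implicit Types (K A : set R) (h g : R -> R).

(** [A] meets [K] and the interior of [K] in the same set, which is then both open and closed
    relative to the connected [A]. *)
Lemma interval_dichotomy K A : closed K -> is_interval A ->
  (forall x, A x -> K x -> K° x) -> A `<=` K° \/ A `&` K = set0.
Proof.
move=> cK /connected_intervalP iA AK.
have [/eqP|] := boolP (A `&` K == set0); first by right.
move=> /set0P AK0; left.
suff <- : A `&` K = A by move=> x [/AK]; exact.
apply: iA => //; last by exists K.
exists K°; first exact: open_interior.
apply/seteqP; split => x [Ax Kx]; split => //; first exact: AK.
exact: interior_subset.
Qed.

Lemma near_right x y : x < y -> \forall e \near (0 : R)^'+, `]x, y[%classic (x + e).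
Proof.
move=> xy; near=> e; rewrite /= in_itv/=; apply/andP; split.
  by rewrite ltrDl; near: e; exact: nbhs_right_gt.
by rewrite -ltrBrDl; near: e; apply: nbhs_right_lt; rewrite subr_gt0.
Unshelve. all: by end_near. Qed.

Lemma near_left x y : x < y -> \forall e \near (0 : R)^'+, `]x, y[%classic (y - e).
Proof.
move=> xy; near=> e; rewrite /= in_itv/=; apply/andP; split.
  rewrite ltrBrDl -ltrBrDr; near: e; apply: nbhs_right_lt; rewrite subr_gt0//.
by rewrite ltrBlDr ltrDl; near: e; exact: nbhs_right_gt.
Unshelve. all: by end_near. Qed.

Lemma near_nbhs (x : R) (U : set R) : nbhs x U ->
  \forall e \near (0 : R)^'+, U (x + e) /\ U (x - e).
Proof.
move=> /nbhs_ballP[r /= r0 rU]; near=> e.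
have e0 : 0 < e by near: e; exact: nbhs_right_gt.
have er : e < r by near: e; exact: nbhs_right_lt.
by split; apply: rU; rewrite /ball/= ?opprD ?opprK addrA subrr add0r ?normrN
  gtr0_norm.
Unshelve. all: by end_near. Qed.

Section FTC.
Variables (K : set R) (h g : R -> R).
Hypothesis compactK : compact K.
Hypothesis ch : {within K, continuous h}.
Hypothesis cg : {within K, continuous g}.
Hypothesis hg : forall x, K° x -> is_derive x 1 (h : R -> R^o) (g x).

Let closedK : closed K.
Proof. by apply: compact_closed compactK; exact: Rhausdorff. Qed.

Let measurableK : measurable (K : set (measurableTypeR R)).
Proof. exact: closed_measurable. Qed.

Let intg (A : set (measurableTypeR R)) : measurable A -> A `<=` K ->
  (leb1 R).-integrable A (EFin \o g).
Proof.
move=> mA AK; apply: (integrableS measurableK) => //.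
exact: continuous_compact_integrable.
Qed.

Let Phi x := \int[leb1 R]_(t in K `&` `]-oo, x]) g t.

Let PhiD x y : x <= y -> Phi y = Phi x + \int[leb1 R]_(t in K `&` `]x, y]) g t.
Proof.
move=> xy; rewrite /Phi -Rintegral_setU.
- congr (Rintegral _ _ _); rewrite -setIUr; congr (_ `&` _).
  apply/seteqP; split => z /=; rewrite !in_itv/=.
    by move=> zy; have [zx|xz] := leP z x; [left|right].
  by move=> [zx|/andP[]//]; exact: le_trans xy.
- exact: measurableI.
- exact: measurableI.
- apply: intg; first by apply: measurableU; exact: measurableI.
  by move=> z [[]|[]].
- apply/disj_setPS => z [[_ /=]] + [_ /=]; rewrite !in_itv/= => zx /andP[xz _].
  by move: (lt_le_trans xz zx); rewrite ltxx.
Qed.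

(** The end points are limits of points of [K], so [h] and [g] are continuous on the whole of
    [[u, v]] and the fundamental theorem of calculus applies. *)
Let piece_in u v : u < v -> `]u, v[ `<=` K° ->
  \int[leb1 R]_(t in K `&` `]u, v]) g t = h v - h u.
Proof.
move=> uv uvK.
have uvK' : `[u, v] `<=` K.
  have ends w : (forall U, nbhs w U -> exists2 z, U z & `]u, v[%classic z) -> K w.
    move=> wuv; apply: closedK => U /wuv[z Uz zuv].
    by exists z; split => //; exact: (interior_subset (uvK _ zuv)).
  move=> w /=; rewrite in_itv/= => /andP[]; rewrite le_eqVlt => /predU1P[<- _|uw].
    apply: ends => U uU.
    have [e [[Ue _] uve]] := filter_ex (filterI (near_nbhs uU) (near_right uv)).
    by exists (u + e).
  rewrite le_eqVlt => /predU1P[->|wv].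
    apply: ends => U uU.
    have [e [[_ Ue] uve]] := filter_ex (filterI (near_nbhs uU) (near_left uv)).
    by exists (v - e).
  by apply: interior_subset; apply: uvK; rewrite /= in_itv/= uw.
have ch' : {within `[u, v], continuous h} by exact: continuous_subspaceW ch.
have cg' : {within `[u, v], continuous g} by exact: continuous_subspaceW cg.
have -> : K `&` `]u, v] = `]u, v]%classic.
  by apply/setIidr; apply: subset_trans uvK'; exact: subset_itv_oc_cc.
rewrite Rintegral_itv_obnd_cbnd; last first.
  apply: intg => //; apply: subset_trans uvK'; exact: subset_itv_oc_cc.
have [_ hu hv] := (continuous_within_itvP h uv).1 ch'.
rewrite /Rintegral (continuous_FTC2 uv cg' (F := h))//.
- split => // x xuv.
  by have [] := hg (uvK x xuv).
- by move=> x xuv; rewrite derive1E; have [_ ->] := hg (uvK x xuv).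
Qed.

(** The end point [v] may still belong to [K], but a single point contributes nothing. *)
Let piece_out u v : u < v -> `]u, v[ `&` K = set0 ->
  \int[leb1 R]_(t in K `&` `]u, v]) g t = 0.
Proof.
move=> uv uvK.
have -> : K `&` `]u, v] = K `&` [set v].
  apply/seteqP; split => x [Kx /=]; rewrite in_itv/=.
    move=> /andP[ux]; rewrite le_eqVlt => /predU1P[|xv]; first by split.
    exfalso; suff : (`]u, v[ `&` K) x by rewrite uvK.
    by split => //=; rewrite in_itv/= ux.
  by move=> xv; split => //; rewrite xv uv lexx.
have [Kv|Kv] := pselect (K v).
  by rewrite (_ : K `&` _ = [set v]) ?Rintegral_set1//; apply/setIidr => _ ->.
rewrite (_ : K `&` _ = set0) ?Rintegral_set0//.
by rewrite -subset0 => x [Kx xv]; apply: Kv; rewrite -xv.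
Qed.

(** The [a i] with [i] in [J] are the boundary points of [K]. The sign is 1 where [K] lies to the
    left of the point and -1 where it lies to the right: the outward normal in dimension one. *)
Variables (I : finType) (J : {set I}) (a sg : I -> R).
Hypothesis inja : {in J &, injective a}.
Hypothesis bdK : forall x, K x -> ~ K° x -> exists2 i, i \in J & x = a i.
Hypothesis sgP : forall i, i \in J ->
  (sg i = 1 /\ \forall e \near (0 : R)^'+, ~ K (a i + e) /\ K (a i - e)) \/
  (sg i = -1 /\ \forall e \near (0 : R)^'+, ~ K (a i - e) /\ K (a i + e)).

Let gap u v : (forall i, i \in J -> ~~ (u < a i < v)) ->
  `]u, v[ `<=` K° \/ `]u, v[ `&` K = set0.
Proof.
move=> Ha; apply: interval_dichotomy => //; first exact: interval_is_interval.
move=> x xuv Kx; apply: contrapT => /(bdK Kx)[i iJ xai].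
by have := Ha i iJ; rewrite -xai; move: xuv => /=; rewrite in_itv/= => ->.
Qed.

Let S x := \sum_(i in J | a i < x) sg i * h (a i).

(** The margin 1 yields a point [L + 1] of []L, x[] outside [K], which rules out the first
    alternative of [gap]. *)
Let lower_bound_lt (x : R) : exists2 L, L + 1 < x & forall y, K y -> L + 1 < y.
Proof.
have [M [_ /(_ (M + 1))]] := compact_bounded compactK.
rewrite ltrDl => /(_ ltr01) KM.
exists (Num.min x (- (M + 1)) - 2).
  have : Num.min x (- (M + 1)) <= x by rewrite ge_min lexx.
  by move=> ?; lra.
move=> y /KM /=; rewrite ler_norml => /andP[My _].
have : Num.min x (- (M + 1)) <= - (M + 1) by rewrite ge_min lexx orbT.
by move=> ?; lra.
Qed.

(* Induction on the number of boundary points below [x]: the left neighbourhood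
   of [x] determines whether [h x] still has to be counted. *)
Let invariant x : exists2 z, z < x &
  (`]z, x[ `<=` K° /\ Phi x = S x + h x) \/
  (`]z, x[ `&` K = set0 /\ Phi x = S x).
Proof.
have [n] := ubnP #|[set i in J | a i < x]|.
elim: n x => // n IH x; rewrite ltnS => xn.
have [/eqP A0|] := boolP ([set i in J | a i < x] == finset.set0).
  have [L L1x KL] := lower_bound_lt x.
  have Lx : L < x by apply: lt_trans L1x; rewrite ltrDl.
  have noa i : i \in J -> ~~ (a i < x).
    by move=> iJ; apply/negP => aix; have := finset.in_set0 i; rewrite -A0 inE iJ aix.
  have LxK : `]L, x[ `&` K = set0.
    have [|LK|//] := @gap L x.
      by move=> i iJ; rewrite negb_and noa// orbT.
    have /LK/interior_subset/KL : `]L, x[%classic (L + 1).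
      by rewrite /= in_itv/= L1x ltrDl ltr01.
    by rewrite ltxx.
  exists L => //; right; split => //.
  rewrite (@PhiD L x) ?ltW// piece_out// addr0 /S big1 ?/Phi.
    rewrite (_ : K `&` _ = set0) ?Rintegral_set0//.
    rewrite -subset0 => y [/KL + /=]; rewrite in_itv/= => Ly yL.
    by have := lt_le_trans Ly yL; rewrite gtrDl ltr10.
  by move=> i /andP[iJ]; rewrite (negPf (noa i iJ)).
move=> /set0Pn[i0]; rewrite inE => /andP[i0J ai0].
pose P i := (i \in J) && (a i < x).
have Pi0 : P i0 by rewrite /P i0J.
(* [a m] is the last boundary point before [x]: none lies strictly between them, and one fewer lies
   below [a m], where the induction hypothesis is applied. *)
have [m /andP[mJ amx] mmax] := arg_maxP a Pi0.
pose y := a m.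
have mmax' i : P i -> a i <= y by exact: mmax.
have PE i : P i = (i \in J) && (a i < y) || (i == m).
  rewrite /P; apply/idP/idP => [/andP[iJ aix]|/orP[/andP[-> aiy]|/eqP->]]/=.
  - rewrite iJ/= lt_neqAle (mmax' i) ?/P ?iJ// andbT orbC.
    have [//|im/=] := eqVneq i m; apply: contra im => /eqP E.
    by apply/eqP; exact: inja.
  - exact: lt_trans amx.
  - by rewrite mJ.
have SE : S x = S y + sg m * h y.
  rewrite /S (bigD1 m)/=; last by rewrite mJ.
  rewrite addrC; congr (_ + _); apply: eq_bigl => i.
  rewrite -/(P i) PE andb_orl andbN orbF.
  have [->|//] := eqVneq i m; last by rewrite andbT.
  by rewrite ltxx !andbF.
have [z zy Hz] : exists2 z, z < y &
  (`]z, y[ `<=` K° /\ Phi y = S y + h y) \/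
  (`]z, y[ `&` K = set0 /\ Phi y = S y).
  apply: IH; apply: leq_trans xn; apply: proper_card.
  apply/properP; split.
    apply/fintype.subsetP => i; rewrite !inE => /andP[-> aiy]/=.
    exact: lt_trans amx.
  by exists m; rewrite !inE ?mJ// ltxx.
have G : `]y, x[ `<=` K° \/ `]y, x[ `&` K = set0.
  apply: gap => i iJ; apply/negP => /andP[yai aix].
  have := mmax' i; rewrite /P iJ aix => /(_ isT).
  by rewrite leNgt yai.
exists y => //.
(* The sign settles the alternative on both sides of [y]. When [K] ends at [y], the pending [h y]
   becomes a term of the sum; when [K] starts at [y], the increment [h x - h y] supplies the new
   term [- h y]. *)
case: (sgP mJ) => -[sgm sgK].
- right; have xK : `]y, x[ `&` K = set0.
    case: G => // yxK; exfalso.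
    have [e [[nK _] /yxK/interior_subset]] := filter_ex (filterI sgK (near_right amx)).
    exact: nK.
  split => //; rewrite (PhiD (ltW amx)) piece_out// addr0 SE sgm mul1r.
  case: Hz => -[zyK] //.
  have [e [[_ Ke] ze]] := filter_ex (filterI sgK (near_left zy)).
  have : (`]z, y[ `&` K) (y - e) by split.
  by rewrite zyK.
- left; have xK : `]y, x[ `<=` K°.
    case: G => // yxK; exfalso.
    have [e [[_ Ke] ye]] := filter_ex (filterI sgK (near_right amx)).
    have : (`]y, x[ `&` K) (y + e) by split.
    by rewrite yxK.
  split => //; rewrite (PhiD (ltW amx)) piece_in// SE sgm mulN1r.
  case: Hz => -[zyK ->]; last by rewrite -/y; ring.
  have [e [[nK _] /zyK/interior_subset]] := filter_ex (filterI sgK (near_left zy)).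
  by move/nK.
Qed.

Lemma line_ftc : \int[leb1 R]_(x in K) g x = \sum_(i in J) sg i * h (a i).
Proof.
have [M [_ /(_ (M + 1))]] := compact_bounded compactK.
rewrite ltrDl => /(_ ltr01) KM.
(* [x] is beyond every [a i] and at least 1 beyond [K], so a point less than 1 to the left of [x]
   excludes the case where [h x] is still pending. *)
pose x := \big[Num.max/(M + 2)]_(i in J) (a i + 1).
have ax i : i \in J -> a i < x.
  by move=> iJ; apply: lt_le_trans (le_bigmax_cond _ (fun i => a i + 1) iJ); rewrite ltrDl.
have Mx : M + 2 <= x by rewrite /x; apply: bigmax_ge_id.
have Kx y : K y -> y <= M + 1.
  by move=> /KM /=; rewrite ler_norml => /andP[].
have [z zx] := invariant x.
have PhiE : Phi x = \int[leb1 R]_(x in K) g x.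
  rewrite /Phi; congr (Rintegral _ _ _); apply/setIidl => y /Kx yM /=.
  rewrite in_itv/=; lra.
have SE : S x = \sum_(i in J) sg i * h (a i).
  by apply: eq_bigl => i; case: (boolP (i \in J)) => //= /ax.
rewrite PhiE SE => -[[zxK _]|[//]].
have [e [zxe e1]] := filter_ex (filterI (near_left zx) (nbhs_right_lt ltr01)).
by have /zxK/interior_subset/Kx := zxe; rewrite /= in e1; lra.
Qed.

End FTC.
End LineFTC.

(** * Slices of the region or of a face by a line *)

Section Slice.
Context {R : realType}.
Local Notation pt := 'rV[R]_3.

Lemma continuous_line (y d : pt) : continuous (fun t : R => y + t *: d).
Proof.
move=> t; apply: cvgD; first exact: cvg_cst.
by apply: cvgZr_tmp; exact: cvg_id.
Qed.

Lemma line_interior (n y d : pt) (D : set pt) (t0 : R) :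
  dot n d = 0 -> relint n D (y + t0 *: d) -> [set t | D (y + t *: d)]° t0.
Proof.
move=> nd rD.
have H : nbhs t0 (fun t => dot n (y + t *: d - (y + t0 *: d)) = 0 -> D (y + t *: d)).
  exact: (@continuous_line y d t0 _ rD).
apply: filterS H => t; apply.
by rewrite opprD addrACA subrr add0r -scalerBl dotZr nd mulr0.
Qed.

Section Boundary.
Variables (D : set pt) (n : pt) (I : finType) (J : {set I}).
Variables (B : I -> set pt) (c o : I -> pt).
Hypothesis compactD : compact D.
Hypothesis closedB : forall i, i \in J -> closed (B i).
Hypothesis bdD : forall x, D x -> ~ relint n D x -> exists2 i, i \in J & B i x.
Hypothesis flatB : forall i x, i \in J -> B i x -> dot (c i) (x - o i) = 0.
Hypothesis c_unit : forall i, i \in J -> dot (c i) (c i) = 1.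
Hypothesis c_n : forall i, i \in J -> dot n (c i) = 0.

Let closedD : closed D.
Proof. by apply: compact_closed compactD; exact: norm_hausdorff. Qed.

(* For [n = 0] the relative interior is the interior and the slices are those of
   a solid; for the normal [n] of a face they are those of the face. *)
Definition good_point x := forall i, i \in J -> B i x ->
  points_out D (c i) x /\ forall j, j \in J -> B j x -> j = i.

(* The half ball cut out of a small ball by the piece [B i] contains no other
   boundary point, so it is either inside or outside D; the normal decides. *)
Let side x i (e : pt) : good_point x -> i \in J -> B i x -> dot n e = 0 ->
  0 < dot (c i) e -> \forall s \near (0 : R)^'+, ~ D (x + s *: e) /\ D (x - s *: e).
Proof.
move=> gx iJ Bx ne ce.
have [out uniqx] := gx i iJ Bx.
have H j : nbhs x (fun y : pt => j \in J -> j != i -> ~ B j y).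
  have [jJ|jJ] := boolP (j \in J); last exact: (filterE (F := nbhs x)).
  have [->|ji] := eqVneq j i; first exact: (filterE (F := nbhs x)).
  suff : nbhs x (~` B j) by apply: filterS => y By _ _.
  apply: open_nbhs_nbhs; split; first exact/closed_openC/closedB.
  by move=> Bjx; move/eqP: ji; apply; exact: uniqx.
have := filter_forall (nbhs_filter x) H.
move=> /nbhs_ballP[r /= r0 rB].
(* Within this ball only [B i] can contain boundary points, and it lies in its plane; a point of [D]
   off that plane is therefore relatively interior. *)
have Bdx y : ball x r y -> dot (c i) (y - x) != 0 -> D y -> relint n D y.
  move=> xy cy Dy; apply: contrapT => /(bdD Dy)[j jJ Bjy].
  have [ji|ji] := eqVneq j i; last exact: (rB y xy j jJ ji).
  have yxE : y - x = (y - o i) - (x - o i) by rewrite opprB addrA subrK.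
  move/eqP: cy; apply; rewrite yxE dotBr (flatB iJ Bx) subr0.
  by apply: flatB => //; rewrite -ji.
(* The segment joining the two points stays in the ball and strictly on one side of the plane of
   [B i], so by [interval_dichotomy] it is either inside [D] or disjoint from it. *)
have key (s sg : R) : 0 < s -> s * (`|e| + `|c i|) < r -> `|sg| = 1 ->
    D (x + (sg * s) *: e) <-> D (x + (sg * s) *: c i).
  move=> s0 sr sg1.
  pose p := x + (sg * s) *: e; pose q := x + (sg * s) *: c i.
  have npq : dot n (q - p) = 0.
    by rewrite /q /p opprD addrACA subrr add0r -scalerBr dotZr dotBr c_n// ne subrr mulr0.
  have ptE t : p + t *: (q - p) = x + (sg * s) *: ((1 - t) *: e + t *: c i).
    rewrite /p /q opprD addrACA subrr add0r -scalerBr -addrA; congr (_ + _).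
    rewrite [t *: _]scalerA (mulrC t) -(scalerA (sg * s) t) -scalerDr; congr (_ *: _).
    by rewrite scalerBr scalerBl scale1r addrA addrAC.
  pose K := [set t : R | D (p + t *: (q - p))].
  have sgs : sg * s != 0 by rewrite -normr_eq0 normrM sg1 mul1r normr_eq0 (gt_eqF s0).
  have cK : closed K.
    by apply: preimage_closed closedD => t _; exact: continuous_line.
  have AK t : `[0, 1]%classic t -> K t -> K° t.
    rewrite /= in_itv/= => /andP[t0 t1] Dt.
    apply: (line_interior npq); apply: Bdx => //.
    + rewrite -ball_normE /ball_/= distrC ptE addrC addKr normrZ normrM sg1 mul1r.
      rewrite gtr0_norm//; apply: le_lt_trans sr; rewrite ler_pM2l//.
      apply: (le_trans (ler_normD _ _)); rewrite !normrZ.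
      rewrite !ger0_norm ?subr_ge0//.
      by apply: lerD; rewrite ler_piMl// lerBlDr lerDl.
    + rewrite ptE addrC addKr dotZr; apply: (mulf_neq0 sgs).
      rewrite dotDr !dotZr c_unit// mulr1 gt_eqF//.
      have [->|t0'] := eqVneq t 0; first by rewrite subr0 mul1r addr0.
      by rewrite ltr_wpDl ?mulr_ge0 ?subr_ge0 ?(ltW ce)// lt_neqAle eq_sym t0'.
  have K0 : K 0 = D p by rewrite /K/= scale0r addr0.
  have K1 : K 1 = D q by rewrite /K/= scale1r addrC subrK.
  have i0 : `[0, 1]%classic (0 : R) by rewrite /= in_itv/= lexx ler01.
  have i1 : `[0, 1]%classic (1 : R) by rewrite /= in_itv/= lexx ler01.
  rewrite -/p -/q -K0 -K1.
  have [AK'|AK'] := interval_dichotomy cK (@interval_is_interval _ `[0, 1]) AK.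
    by split => _; apply: interior_subset; apply: AK'.
  have nK u : `[0, 1]%classic u -> ~ K u.
    by move=> iu Ku; have : (`[0, 1]%classic `&` K) u by []; rewrite AK'.
  by split => [/(nK 0 i0)|/(nK 1 i1)].
near=> s.
have s0 : 0 < s by near: s; exact: nbhs_right_gt.
have sr : s * (`|e| + `|c i|) < r.
  have M1 : 0 < `|e| + `|c i| + 1 by rewrite ltr_wpDl// addr_ge0.
  apply: (@le_lt_trans _ _ (s * (`|e| + `|c i| + 1))).
    by rewrite ler_pM2l// lerDl.
  rewrite -ltr_pdivlMr//; near: s; apply: nbhs_right_lt.
  exact: divr_gt0.
have [nDc Dc] : ~ D (x + s *: c i) /\ D (x - s *: c i) by near: s.
have := key s 1 s0 sr (normr1 _); rewrite mul1r => [[h1 _]].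
have := key s (-1) s0 sr (normrN1 _); rewrite mulN1r !scaleNr => [[_ h2]].
by split; [move/h1|exact: h2].
Unshelve. all: by end_near. Qed.

Variables (e x0 : pt).
Hypothesis e_unit : dot e e = 1.
Hypothesis e_n : dot n e = 0.
Variables (h g : pt -> R).
Hypothesis ch : {within D, continuous h}.
Hypothesis cg : {within D, continuous g}.
Hypothesis hg : forall s : R, relint n D (x0 + s *: e) ->
  is_derive s 1 ((fun s => h (x0 + s *: e)) : R -> R^o) (g (x0 + s *: e)).
Hypothesis good : forall s, good_point (x0 + s *: e).
Hypothesis transverse : forall s i, i \in J -> B i (x0 + s *: e) ->
  dot (c i) e != 0.

(** The quotient is the parameter at which the line crosses the plane of [B i]. Extending [h] by
    zero off [B i] suppresses the planes crossed elsewhere, so the sum runs over the same [J] for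
    every line and can be integrated in [x0]. *)
Lemma slice_ftc : \int[leb1 R]_(s in [set s | D (x0 + s *: e)]) g (x0 + s *: e) =
  \sum_(i in J) Num.sg (dot (c i) e) *
    (h \_ (B i)) (x0 + (dot (c i) (o i - x0) / dot (c i) e) *: e).
Proof.
pose K := [set s : R | D (x0 + s *: e)].
pose t i := dot (c i) (o i - x0) / dot (c i) e.
pose J' := [set i in J | x0 + t i *: e \in B i].
have sides s i : i \in J -> B i (x0 + s *: e) ->
  (Num.sg (dot (c i) e) = 1 /\ \forall r \near (0 : R)^'+, ~ K (s + r) /\ K (s - r)) \/
  (Num.sg (dot (c i) e) = -1 /\ \forall r \near (0 : R)^'+, ~ K (s - r) /\ K (s + r)).
  move=> iJ Bi; have := transverse iJ Bi.
  rewrite neq_lt => /orP[neg|pos]; [right|left].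
    rewrite ltr0_sg//; split => //.
    have := @side _ i (- e) (@good s) iJ Bi; rewrite !dotNr e_n oppr0 oppr_gt0.
    move=> /(_ erefl neg); apply: filterS => r; rewrite !scalerN opprK /K /=.
    by rewrite scalerBl scalerDl !addrA.
  rewrite gtr0_sg//; split => //.
  have := @side _ i e (@good s) iJ Bi e_n pos; apply: filterS => r; rewrite /K/=.
  by rewrite scalerBl scalerDl !addrA.
have tE s i : i \in J -> B i (x0 + s *: e) -> s = t i.
  move=> iJ Bi; have ce := transverse iJ Bi.
  have := flatB iJ Bi; rewrite /t !dotBr dotDr dotZr => E.
  by apply: (mulIf ce); rewrite divfK//; lra.
have cK : compact K.
  have [M [_ /(_ (M + 1))]] := compact_bounded compactD.
  rewrite ltrDl => /(_ ltr01) DM.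
  (* As [e] is a unit vector, [s] is the difference of the values of [dot e] at the point of
     parameter [s] and at [x0], which [N] bounds by [dot_norm_le]. *)
  pose N := 3 * `|e| * (M + 1) + `|dot e x0|.
  apply: (@subclosed_compact _ K `[- N, N]).
  - by apply: preimage_closed closedD => s _; exact: continuous_line.
  - exact: segment_compact.
  - move=> s /DM /= sM; rewrite in_itv/= -ler_norml.
    have sE : dot e (x0 + s *: e) - dot e x0 = s.
      by rewrite dotDr dotZr e_unit mulr1 addrAC subrr add0r.
    rewrite -[X in `|X|]sE.
    apply: (le_trans (ler_normB _ _)); rewrite lerD2r.
    apply: (le_trans (dot_norm_le _ _)).
    by rewrite ler_wpM2l// mulr_ge0.
(* A boundary piece through the point would leave one side of [s] outside [K], whatever its sign. *)
have relK s : K° s -> relint n D (x0 + s *: e).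
  move=> Ks; apply: contrapT => /(bdD (interior_subset Ks))[i iJ Bi].
  have [[_ H]|[_ H]] := sides _ _ iJ Bi.
    by have [r [[nK _] [Kr _]]] := filter_ex (filterI H (near_nbhs Ks)).
  by have [r [[nK _] [_ Kr]]] := filter_ex (filterI H (near_nbhs Ks)).
have J'P i : i \in J' -> i \in J /\ B i (x0 + t i *: e).
  by rewrite finset.inE => /andP[iJ /set_mem].
have injt : {in J' &, injective t}.
  move=> i j /J'P[iJ Bi] /J'P[jJ Bj] tij; rewrite tij in Bi.
  by have [_ H] := @good (t j) j jJ Bj; exact: H.
have cline (f : pt -> R) : {within D, continuous f} ->
    {within K, continuous (fun s => f (x0 + s *: e))}.
  by apply: (within_continuous_comp _ _) => // s; exact: continuous_line.
have bdK s : K s -> ~ K° s -> exists2 i, i \in J' & s = t i.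
  move=> Ks nKs; have [|i iJ Bi] := bdD Ks.
    by move=> /(line_interior e_n).
  by exists i; [rewrite finset.inE iJ/= -(tE s)// mem_set|exact: tE].
have sgK i : i \in J' ->
  (Num.sg (dot (c i) e) = 1 /\
     \forall r \near (0 : R)^'+, ~ K (t i + r) /\ K (t i - r)) \/
  (Num.sg (dot (c i) e) = -1 /\
     \forall r \near (0 : R)^'+, ~ K (t i - r) /\ K (t i + r)).
  by move=> /J'P[iJ Bi]; exact: sides.
rewrite (line_ftc cK (cline h ch) (cline g cg) (fun s Ks => hg (relK s Ks))
  injt bdK sgK).
rewrite [in RHS](bigID (fun i => i \in J'))/= [X in _ = _ + X]big1 ?addr0.
  apply: eq_big => [i|i /J'P[iJ Bi]]; last by rewrite patchE mem_set.
  by rewrite andb_idl// => /J'P[].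
move=> i /andP[iJ]; rewrite finset.inE iJ /= => /negPf tB.
by rewrite patchE tB mulr0.
Qed.

End Boundary.
End Slice.

(** * Geometry of the polyhedron *)

Section OrthonormalBasis.
Context {R : realType}.
Local Notation pt := 'rV[R]_3.
Implicit Types u v w x : pt.

Definition orthonormal3 u v w :=
  [/\ dot u u = 1, dot v v = 1 & dot w w = 1] /\
  [/\ dot u v = 0, dot u w = 0 & dot v w = 0].

Let frame_mx u v w : 'M[R]_3 := \matrix_(i, j) [:: u; v; w]`_i 0 j.

(** Orthonormal rows mean that the transpose is a right inverse; for a square matrix it is also a
    left inverse, so the columns are orthonormal too. *)
Let frame_mxE u v w : orthonormal3 u v w ->
  (frame_mx u v w)^T *m frame_mx u v w = 1%:M.
Proof.
move=> [[uu vv ww] [uv uw vw]]; apply: mulmx1C; apply/matrixP => i j.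
rewrite !mxE.
transitivity (dot [:: u; v; w]`_i [:: u; v; w]`_j).
  by apply: eq_bigr => k _; rewrite !mxE.
case: i => -[|[|[|//]]] hi; case: j => -[|[|[|//]]] hj //=;
  by rewrite ?(dotC v u) ?(dotC w u) ?(dotC w v).
Qed.

Lemma orthonormal3_col u v w i j : orthonormal3 u v w ->
  u 0 i * u 0 j + v 0 i * v 0 j + w 0 i * w 0 j = (i == j)%:R.
Proof.
move=> /frame_mxE /matrixP /(_ i j); rewrite !mxE => <-.
by rewrite !big_ord_recl big_ord0 !mxE /= addr0 addrA.
Qed.

Lemma orthonormal3_expand u v w x : orthonormal3 u v w ->
  x = dot u x *: u + dot v x *: v + dot w x *: w.
Proof.
move=> o3; apply/rowP => j; rewrite !mxE /dot !mulr_suml -!big_split /=.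
transitivity (\sum_i x 0 i * (i == j)%:R).
  rewrite (bigD1 j)//= eqxx mulr1 big1 ?addr0// => i /negPf ->.
  by rewrite mulr0.
by apply: eq_bigr => i _; rewrite -(orthonormal3_col i j o3); ring.
Qed.

Lemma orthonormal3_dot u v w x y : orthonormal3 u v w ->
  dot x y = dot u x * dot u y + dot v x * dot v y + dot w x * dot w y.
Proof.
move=> o3; rewrite {1}(orthonormal3_expand x o3) !dotDl !dotZl.
by [].
Qed.

Lemma orthonormal3_perm u v w : orthonormal3 u v w -> orthonormal3 u w v.
Proof. by move=> [[? ? ?] [? ? ?]]; split; split; rewrite // dotC. Qed.

End OrthonormalBasis.

Section Region.
Context {R : realType} (P : polyhedron R).
Local Notation pt := 'rV[R]_3.
Implicit Types (f : face P) (e : edge P).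

Lemma relint0 (D : set pt) : relint 0 D = D°.
Proof.
apply/seteqP; split => x; rewrite /relint /interior /=;
  apply: filterS => y; last by move=> ? _.
by apply; rewrite dot0l.
Qed.

Lemma compact_region : compact (region P).
Proof. exact: (@bounded_closed_compact R _ (region P) (@region_bounded R P) (@region_closed R P)). Qed.

Lemma fset_region f : fset f `<=` region P.
Proof.
move=> x fx; have : (region P `\` (region P)°) x.
  by rewrite region_boundary; exists f.
by case.
Qed.

Lemma closed_fset f : closed (fset f).
Proof. by rewrite -(face_regular f); exact: closed_closure. Qed.

Lemma compact_fset f : compact (fset f).
Proof.
apply: (@subclosed_compact _ _ (region P)).
- exact: closed_fset.
- exact: compact_region.
- exact: fset_region.
Qed.

Lemma edge_face_ex e : exists f, e \in fedges f.
Proof.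
have : (0 < #|[set f : face P | e \in fedges f]|)%N by rewrite edge_two_faces.
by case/card_gt0P => f; rewrite inE; exists f.
Qed.

Lemma eset_fset f e : e \in fedges f -> eset e `<=` fset f.
Proof.
move=> ef x ex; have : (fset f `\` relint (fnormal f) (fset f)) x.
  by rewrite face_boundary; exists e.
by case.
Qed.

Lemma eset_region e : eset e `<=` region P.
Proof.
have [f ef] := edge_face_ex e.
by apply: subset_trans (@fset_region f); exact: eset_fset.
Qed.

Lemma edge_vec_neq0 e : vpos (etgt e) - vpos (esrc e) != 0.
Proof.
rewrite subr_eq0; apply/eqP => /vpos_inj E.
by have := edge_nondegenerate e; rewrite E eqxx.
Qed.

Lemma elen_gt0 e : 0 < elen e.
Proof.
by rewrite /elen /enorm sqrtr_gt0 lt_neqAle dot_ge0 andbT eq_sym dot_eq0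
  edge_vec_neq0.
Qed.

Lemma elen_sqr e :
  elen e ^+ 2 = dot (vpos (etgt e) - vpos (esrc e)) (vpos (etgt e) - vpos (esrc e)).
Proof. by rewrite sqr_sqrtr// dot_ge0. Qed.

Lemma etan_unit e : dot (etan e) (etan e) = 1.
Proof.
have e0 := elen_gt0 e.
by rewrite dotZl dotZr -elen_sqr expr2; field; rewrite gt_eqF.
Qed.

Lemma edge_vecE e : vpos (etgt e) - vpos (esrc e) = elen e *: etan e.
Proof. by rewrite scalerA mulfV ?scale1r// gt_eqF// elen_gt0. Qed.

Definition epath e (s : R) : pt := vpos (esrc e) + s *: etan e.

(** Passes from the affine parameter of [segment] to arc length, the variable of [int_edge]. *)
Lemma esetP e x : eset e x <-> exists2 s, 0 <= s <= elen e & x = epath e s.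
Proof.
have e0 := elen_gt0 e.
split => [[s /=]|[s /andP[s0 s1] ->]].
  rewrite in_itv/= => /andP[s0 s1] <-; exists (s * elen e).
    by rewrite mulr_ge0 ?(ltW e0)//= ler_piMl// ltW.
  by rewrite edge_vecE scalerA.
exists (s / elen e); rewrite /= ?in_itv/=.
  by rewrite divr_ge0 ?(ltW e0)//= ler_pdivrMr// mul1r.
by rewrite edge_vecE scalerA divfK ?gt_eqF.
Qed.

Lemma epath_inj e : injective (epath e).
Proof.
move=> s t /addrI E; have := congr1 (dot (etan e)) E.
by rewrite (dotZr s) (dotZr t) etan_unit !mulr1.
Qed.

Lemma epath_eset e s : eset e (epath e s) <-> 0 <= s <= elen e.
Proof.
rewrite esetP; split => [[t + /epath_inj ->]//|h]; by exists s.
Qed.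

Lemma eset_open_segment e x : eset e x -> x <> vpos (esrc e) ->
  x <> vpos (etgt e) -> open_segment (vpos (esrc e)) (vpos (etgt e)) x.
Proof.
move=> [s /=]; rewrite in_itv/= => /andP[s0 s1] <- x0 x1; exists s => //=.
rewrite in_itv/= !lt_neqAle s0 s1 !andbT; apply/andP; split.
  by apply/eqP => E; apply: x0; rewrite -E scale0r addr0.
by apply/eqP => E; apply: x1; rewrite E scale1r addrC subrK.
Qed.

Lemma compact_eset e : compact (eset e).
Proof.
apply: continuous_compact (@segment_compact R 0 1).
by apply: continuous_subspaceT => t; exact: continuous_line.
Qed.

Lemma closed_eset e : closed (eset e).
Proof. by apply: compact_closed (@compact_eset e); exact: norm_hausdorff. Qed.

Lemma face_orthonormal f : orthonormal3 (fnormal f) (ftan1 f) (ftan2 f).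
Proof. exact: face_frame. Qed.

Lemma fout_orthonormal f : orthonormal3 (fout f) (ftan1 f) (ftan2 f).
Proof.
have [cc c1 c2] := fout_unit f.
by have [[_ t1 t2] [_ _ t12]] := face_frame f.
Qed.

Lemma face_chart f x : dot (fnormal f) (x - forigin f) = 0 ->
  x = chart f (dot (ftan1 f) (x - forigin f), dot (ftan2 f) (x - forigin f)).
Proof.
move=> nx; rewrite /chart/= -addrA.
rewrite -{1}(subrK (forigin f) x) addrC; congr (_ + _).
by rewrite {1}(orthonormal3_expand (x - forigin f) (face_orthonormal f)) nx scale0r add0r.
Qed.

Lemma fout_flat f x : fset f x -> dot (fout f) (x - forigin f) = 0.
Proof.
move=> /face_flat /face_chart; rewrite /chart/= -addrA => E.
have [_ c1 c2] := fout_unit f.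
rewrite {1}E addrAC subrr add0r dotDr !dotZr c1 c2 !mulr0 addr0//.
Qed.

Lemma edge_orthonormal f e : e \in fedges f ->
  orthonormal3 (fnormal f) (etan e) (conormal f e).
Proof.
move=> ef; have [cc cn ct] := conormal_unit ef.
have [[nn _ _] _] := face_frame f.
split; split; rewrite ?etan_unit ?(dotC (fnormal f))//; last first.
  by rewrite dotZl dotC ct mulr0.
have src : fset f (vpos (esrc e)).
  by apply: (eset_fset ef); exists 0; rewrite ?scale0r ?addr0//= in_itv/= lexx ler01.
have tgt : fset f (vpos (etgt e)).
  by apply: (eset_fset ef); exists 1;
    rewrite ?scale1r ?(addrC (vpos (esrc e))) ?subrK//= in_itv/= lexx ler01.
have := face_flat tgt; have := face_flat src; rewrite !dotBr => h1 h2.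
rewrite dotZl dotBl !(dotC _ (fnormal f)).
rewrite (_ : dot (fnormal f) _ - _ = 0) ?mulr0//.
by rewrite (subr0_eq h1) (subr0_eq h2) subrr.
Qed.

End Region.

(** * Null sets, finite measures and parametrizations in the plane and in space *)

Section MorePlane.
Context {R : realType}.
Local Notation line := (measurableTypeR R).
Local Notation plane := (line * line)%type.
Local Notation space := (plane * line)%type.
Local Notation pt := 'rV[R]_3.

Lemma leb2_translate (u v : R) :
  scales (leb2 R) (fun p : plane => (p.1 + u, p.2 + v) : plane) (leb2 R) 1.
Proof.
have tr1 (w : R) := @leb1_affine R 1 w (oner_neq0 _).
set phi : plane -> plane := fun p : plane => _.
have mphi : measurable_fun setT phi.
  apply: measurable_fun_pair => //=.
  - by apply: measurable_funD.
  - by apply: measurable_funD.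
split => // S mS; rewrite mul1e.
have [m' m'E] := pushforward_measure (leb2 R) mphi.
rewrite -m'E; apply/esym.
apply: (@product_measure_unique _ _ _ _ _ (@lebesgue_measure R) (@lebesgue_measure R) m' _ S mS).
move=> A B mA mB; rewrite m'E.
have mt (w : R) (C : set line) : measurable C ->
    measurable ((fun x : line => 1 * x + w : line) @^-1` C) /\
    leb1 R ((fun x : line => 1 * x + w : line) @^-1` C) = leb1 R C.
  move=> mC; have [_ mf E] := tr1 w; split.
    by rewrite -[X in measurable X]setTI; exact: mf.
  by rewrite E// normr1 invr1 mul1e.
have -> : phi @^-1` (A `*` B) =
  ((fun x : line => 1 * x + u : line) @^-1` A) `*`
  ((fun x : line => 1 * x + v : line) @^-1` B).
  by apply/seteqP; split => -[x y] /=; rewrite !mul1r.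
have [mA' EA] := mt u A mA; have [mB' EB] := mt v B mB.
by rewrite leb2_setX// EA EB.
Qed.

Lemma leb2_affine (a b c d u v : R) : a * d - b * c != 0 ->
  scales (leb2 R)
    (fun p : plane => (a * p.1 + b * p.2 + u, c * p.1 + d * p.2 + v) : plane)
    (leb2 R) `|a * d - b * c|^-1.
Proof.
move=> D; have := scales_comp (leb2_linear D) (leb2_translate u v).
by rewrite mulr1.
Qed.

Definition plane_line (al be ga : R) : set plane :=
  [set q | al * q.1 + be * q.2 = ga].

(** The linear map with rows [al], [be] and [- be], [al] has determinant al^2 + be^2 and takes this
    line into the vertical line of abscissa [ga]. *)
Lemma plane_line_null (al be ga : R) : (al != 0) || (be != 0) ->
  measurable (plane_line al be ga) /\ leb2 R (plane_line al be ga) = 0%E.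
Proof.
move=> ab.
have D : al * al - be * (- be) != 0.
  rewrite mulrN opprK paddr_eq0; [|by rewrite -expr2 sqr_ge0..].
  by rewrite !mulf_eq0 !orbb negb_and.
have [_ mphi phiE] := leb2_linear D.
have m1 : measurable ([set ga] `*` setT : set plane) by exact: measurableX.
have E : (fun p : plane => (al * p.1 + be * p.2, - be * p.1 + al * p.2) : plane)
    @^-1` ([set ga] `*` setT) = plane_line al be ga.
  by apply/seteqP; split => -[x y] /= => [[]|].
split.
  by rewrite -E -[X in measurable X]setTI; exact: mphi.
rewrite -E phiE// leb2_setX//.
by rewrite (_ : leb1 R [set ga] = 0%E) ?mul0e ?mule0//; exact: lebesgue_measure_set1.
Qed.

Lemma null_bigcup d (T : measurableType d) (mu : {measure set T -> \bar R})
    (I : finType) (F : I -> set T) :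
  (forall i, measurable (F i) /\ mu (F i) = 0%E) ->
  measurable (\bigcup_i F i) /\ mu (\bigcup_i F i) = 0%E.
Proof.
move=> F0; rewrite (_ : \bigcup_i F i = \big[setU/set0]_(i : I) F i); last first.
  rewrite -bigcup_seq; congr (\bigcup_(i in _) _).
  by apply/seteqP; split => i //= _; rewrite mem_index_enum.
elim/big_ind : _ => [|A B [mA A0] [mB B0]|i _]; last exact: F0.
  by split => //; exact: measure0.
split; first exact: measurableU.
by rewrite measureU0.
Qed.

Lemma Rintegral_sum d (T : measurableType d) (mu : {measure set T -> \bar R})
    (I : Type) (r : seq I) (Q : pred I) (f : I -> T -> R) :
  (forall i, Q i -> mu.-integrable setT (EFin \o f i)) ->
  mu.-integrable setT (EFin \o (fun x => \sum_(i <- r | Q i) f i x)) /\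
  \int[mu]_x (\sum_(i <- r | Q i) f i x) = \sum_(i <- r | Q i) \int[mu]_x f i x.
Proof.
move=> intf; elim: r => [|i r [IH1 IH2]].
  split.
    rewrite (_ : _ \o _ = cst 0%E); first exact: integrable0.
    by apply/funext => x /=; rewrite big_nil.
  rewrite big_nil; under eq_Rintegral do rewrite big_nil.
  by rewrite Rintegral_cst// mul0r.
have [Qi|Qi] := boolP (Q i).
  have E : (fun x => \sum_(j <- i :: r | Q j) f j x) =
      (fun x => f i x + \sum_(j <- r | Q j) f j x).
    by apply/funext => x; rewrite big_cons Qi.
  rewrite E big_cons Qi; split; last by rewrite RintegralD ?IH2//; exact: intf.
  rewrite (_ : _ \o _ = (EFin \o f i) \+ (EFin \o (fun x => (\sum_(j <- r | Q j) f j x)%R)))%E//.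
  by apply: integrableD => //; exact: intf.
have E : (fun x => \sum_(j <- i :: r | Q j) f j x) =
    (fun x => \sum_(j <- r | Q j) f j x).
  by apply/funext => x; rewrite big_cons (negPf Qi).
by rewrite E big_cons (negPf Qi).
Qed.

Lemma measurable_base_plane : measurable_base (fun p : plane => p : R * R).
Proof.
have := measurable_base_prod (measurable_base_R R) (measurable_base_R R).
by rewrite (_ : (fun p => _) = (fun p : plane => p : R * R))//; apply/funext => -[].
Qed.

Lemma measurable_base_space : measurable_base (fun p : space => p : R * R * R).
Proof.
have := measurable_base_prod measurable_base_plane (measurable_base_R R).
by rewrite (_ : (fun p => _) = (fun p : space => p : R * R * R))//; apply/funext => -[].
Qed.

Lemma continuous_frame (T : topologicalType) (o a b : pt) (u v : T -> R) :
  continuous u -> continuous v -> continuous (fun p => o + u p *: a + v p *: b).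
Proof.
move=> cu cv p; apply: cvgD; last by apply: cvgZr_tmp; exact: cv.
by apply: cvgD; [exact: cvg_cst|apply: cvgZr_tmp; exact: cu].
Qed.

Lemma continuous_pt_of : continuous (@pt_of R).
Proof.
move=> p; rewrite (_ : @pt_of R = fun p : R * R * R =>
  p.1.1 *: delta_mx 0 0 + p.1.2 *: delta_mx 0 1 + p.2 *: delta_mx 0 2%:R); last first.
  by apply/funext => q; rewrite /pt_of vec3_scale.
apply: cvgD; last by apply: cvgZr_tmp; exact: cvg_snd.
apply: cvgD; apply: cvgZr_tmp.
  by apply: (@cvg_comp _ _ _ fst fst _ (nbhs p.1)); exact: cvg_fst.
by apply: (@cvg_comp _ _ _ fst snd _ (nbhs p.1)); [exact: cvg_fst|exact: cvg_snd].
Qed.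

Lemma leb1_itv_lty (a b : R) : (leb1 R `[a, b]%classic < +oo)%E.
Proof.
by apply: (@compact_finite_measure R); exact: segment_compact.
Qed.

Lemma leb2_box_lty (A : set plane) (M : R) : measurable A ->
  (forall p, A p -> `|p.1| <= M /\ `|p.2| <= M) -> (leb2 R A < +oo)%E.
Proof.
move=> mA AM; apply: (@le_lt_trans _ _ (leb2 R (`[- M, M] `*` `[- M, M]))).
  apply: le_measure; rewrite ?inE//; first exact: measurableX.
  by move=> p /AM[]; rewrite !ler_norml /= !in_itv/=.
by rewrite leb2_setX// lte_mul_pinfty ?ge0_fin_numE ?leb1_itv_lty.
Qed.

Lemma leb3_box_lty (A : set space) (M : R) : measurable A ->
  (forall p, A p -> [/\ `|p.1.1| <= M, `|p.1.2| <= M & `|p.2| <= M]) ->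
  (leb3 R A < +oo)%E.
Proof.
move=> mA AM.
apply: (@le_lt_trans _ _ (leb3 R ((`[- M, M] `*` `[- M, M]) `*` `[- M, M]))).
  apply: le_measure; rewrite ?inE//.
    by apply: measurableX => //; exact: measurableX.
  by move=> p /AM[]; rewrite !ler_norml /= !in_itv/=.
rewrite leb3_setX//; last exact: measurableX.
rewrite leb2_setX// lte_mul_pinfty ?mule_ge0// ?ge0_fin_numE ?mule_ge0//
  ?lte_mul_pinfty ?ge0_fin_numE ?leb1_itv_lty//.
Qed.

End MorePlane.

(** * Integrals over the region, its faces and its edges *)

Section Integrals.
Context {R : realType} (P : polyhedron R).
Local Notation line := (measurableTypeR R).
Local Notation plane := (line * line)%type.
Local Notation space := (plane * line)%type.
Local Notation pt := 'rV[R]_3.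
Implicit Types (f : face P) (e : edge P).

Lemma compact_dot_bounded (D : set pt) (u o : pt) : compact D ->
  exists M, forall x, D x -> `|dot u (x - o)| <= M.
Proof.
move=> cD; apply: (within_continuous_compact_bounded cD).
have -> : (fun y => dot u (y - o)) = (fun y => dot u y - dot u o).
  by apply/funext => y; rewrite dotBr.
by apply: continuous_subspaceT => x; exact: (cvgB (@continuous_dotr R u x) (cvg_cst _)).
Qed.

Lemma Rintegral_patch d (T : measurableType d) (mu : {measure set T -> \bar R})
    (gam : T -> pt) (D : set pt) (g : pt -> R) :
  \int[mu]_(p in gam @^-1` D) g (gam p) = \int[mu]_p (g \_ D) (gam p).
Proof.
by rewrite Rintegral_mkcond.
Qed.

Lemma vol_lty : (leb3 R (@pt_of R @^-1` region P) < +oo)%E.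
Proof.
have [M [_ /(_ (`|M| + 1))]] := compact_bounded (@compact_region R P).
rewrite (le_lt_trans (ler_norm _)) ?ltrDl// => /(_ isT) DM.
apply: (@leb3_box_lty _ _ (`|M| + 1)).
  exact: (measurable_param (@measurable_base_space R) (@continuous_pt_of R)
    (@compact_region R P)).
move=> p /DM pM; split; apply: le_trans pM.
- by rewrite -[p.1.1](vec30 p.1.1 p.1.2 p.2); exact: coord_norm_le.
- by rewrite -[p.1.2](vec31 p.1.1 p.1.2 p.2); exact: coord_norm_le.
- by rewrite -[p.2](vec32 p.1.1 p.1.2 p.2); exact: coord_norm_le.
Qed.

Lemma continuous_chart f : continuous (chart f).
Proof. by apply: continuous_frame => x; [exact: cvg_fst|exact: cvg_snd]. Qed.

Lemma chart_coord f p :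
  dot (ftan1 f) (chart f p - forigin f) = p.1 /\
  dot (ftan2 f) (chart f p - forigin f) = p.2.
Proof.
have [[_ t1 t2] [_ _ t12]] := face_frame f.
have -> : chart f p - forigin f = p.1 *: ftan1 f + p.2 *: ftan2 f.
  by rewrite /chart -(addrA (forigin f)) addrAC subrr add0r.
split; rewrite dotDr !dotZr.
  by rewrite t1 t12 mulr1 mulr0 addr0.
by rewrite t2 dotC t12 mulr1 mulr0 add0r.
Qed.

Lemma face_lty f : (leb2 R (chart f @^-1` fset f) < +oo)%E.
Proof.
have [M1 fM1] := compact_dot_bounded (ftan1 f) (forigin f) (@compact_fset R P f).
have [M2 fM2] := compact_dot_bounded (ftan2 f) (forigin f) (@compact_fset R P f).
apply: (@leb2_box_lty _ _ (Num.max M1 M2)).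
  exact: (measurable_param (@measurable_base_plane R) (@continuous_chart f)
    (@compact_fset R P f)).
move=> p fp; have [<- <-] := chart_coord f p.
by split; rewrite le_max ?fM1 ?fM2// orbT.
Qed.

Lemma epath_preimage e : epath e @^-1` eset e = `[0, elen e]%classic.
Proof.
by apply/seteqP; split => s /=; rewrite in_itv/= => /epath_eset.
Qed.

Lemma edge_lty e : (leb1 R (epath e @^-1` eset e) < +oo)%E.
Proof. by rewrite epath_preimage; exact: leb1_itv_lty. Qed.

Lemma continuous_epath e : continuous (epath e).
Proof. by move=> s; exact: continuous_line. Qed.

Lemma int_edgeE e (g : pt -> R) :
  int_edge e g = \int[leb1 R]_(s in epath e @^-1` eset e) g (epath e s).
Proof. by rewrite epath_preimage. Qed.

Lemma integral_on_vol : integral_on (region P) (int_vol (region P)).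
Proof.
exact: (integral_on_param (@measurable_base_space R) (@continuous_pt_of R)
  (@compact_region R P) vol_lty).
Qed.

Lemma integral_on_face f : integral_on (fset f) (int_face f).
Proof.
exact: (integral_on_param (@measurable_base_plane R) (@continuous_chart f)
  (@compact_fset R P f) (face_lty f)).
Qed.

Lemma integral_on_edge e : integral_on (eset e) (int_edge e).
Proof.
have := integral_on_param (measurable_base_R R) (@continuous_epath e)
  (@compact_eset R P e) (edge_lty e).
by rewrite (_ : (fun g => _) = int_edge e)//; apply/funext => g; rewrite int_edgeE.
Qed.

(** Carries finiteness from the chart of a face or an edge to its projection, the factor [c] being
    positive. *)
Lemma scales_lty d1 d2 (X : measurableType d1) (Y : measurableType d2)
    (m1 : {measure set X -> \bar R}) (m2 : {measure set Y -> \bar R})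
    (phi : X -> Y) (c : R) (S : set Y) :
  scales m1 phi m2 c -> measurable S -> (m1 (phi @^-1` S) < +oo)%E ->
  (m2 S < +oo)%E.
Proof.
move=> [c0 _ phiE] mS; rewrite phiE//.
have := measure_ge0 m2 S; case: (m2 S) => [r _ _|_|//]; first exact: ltry.
by rewrite mulry gtr0_sg// mul1e ltxx.
Qed.

End Integrals.

(** * Projection of a face along a direction *)

Section Volume.
Context {R : realType} (P : polyhedron R).
Local Notation line := (measurableTypeR R).
Local Notation plane := (line * line)%type.
Local Notation space := (plane * line)%type.
Local Notation pt := 'rV[R]_3.
Implicit Types (f : face P) (e b : pt).

Definition base b1 b2 (q : R * R) : pt := q.1 *: b1 + q.2 *: b2.

Lemma continuous_base b1 b2 : continuous (base b1 b2).
Proof.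
move=> q; apply: cvgD; apply: cvgZr_tmp; [exact: cvg_fst|exact: cvg_snd].
Qed.

Lemma delta_orthonormal (i j k : 'I_3) : i != j -> i != k -> j != k ->
  orthonormal3 (delta_mx 0 i : pt) (delta_mx 0 j) (delta_mx 0 k).
Proof.
have dd (a b : 'I_3) : dot (delta_mx 0 a : pt) (delta_mx 0 b) = (a == b)%:R.
  rewrite /dot (bigD1 a)//= !mxE !eqxx /= mul1r big1 ?addr0// => c /negPf ca.
  by rewrite !mxE ca andbF mul0r.
move=> /negPf ij /negPf ik /negPf jk.
by split; split; rewrite dd ?eqxx ?ij ?ik ?jk.
Qed.

(** [sig] permutes the coordinates so that direction [k] comes last and is the inner variable when
    [leb3] is split by Fubini's theorem. *)
Lemma volume_frame (k : 'I_3) : exists b1 b2 (sig : space -> space),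
  [/\ orthonormal3 (delta_mx 0 k) b1 b2, scales (leb3 R) sig (leb3 R) 1 &
      forall q s, pt_of (sig (q, s)) = base b1 b2 q + s *: delta_mx 0 k].
Proof.
case: k => -[|[|[|//]]] hk.
- rewrite (_ : Ordinal hk = 0); last exact/val_inj.
  exists (delta_mx 0 1), (delta_mx 0 2%:R), (fun p : space => ((p.2, p.1.1), p.1.2)).
  split; first exact: delta_orthonormal.
    by have := scales_comp (@leb3_swap23 R) (@leb3_swap12 R); rewrite mulr1.
  by move=> q s; rewrite /pt_of /= vec3_scale /base -addrA addrC.
- rewrite (_ : Ordinal hk = 1); last exact/val_inj.
  exists (delta_mx 0 0), (delta_mx 0 2%:R), (fun p : space => ((p.1.1, p.2), p.1.2)).
  split; [exact: delta_orthonormal|exact: leb3_swap23|].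
  by move=> q s; rewrite /pt_of /= vec3_scale /base addrAC.
- rewrite (_ : Ordinal hk = 2%:R); last exact/val_inj.
  exists (delta_mx 0 0), (delta_mx 0 1), id.
  split; first exact: delta_orthonormal.
    by split => // S mS; rewrite mul1e.
  by move=> q s; rewrite /pt_of /= vec3_scale.
Qed.

(** The point of the plane of [f] above [q] in the direction [e], in the form in which [slice_ftc]
    produces it. *)
Definition face_proj f e b1 b2 (q : R * R) : pt :=
  base b1 b2 q + (dot (fout f) (forigin f - base b1 b2 q) / dot (fout f) e) *: e.

Section Projection.
Variables (f : face P) (e b1 b2 : pt).
Hypothesis eb : orthonormal3 e b1 b2.
Hypothesis ce : dot (fout f) e != 0.

Let t1 := ftan1 f.
Let t2 := ftan2 f.
Let det := dot b1 t1 * dot b2 t2 - dot b1 t2 * dot b2 t1.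

(* Both sides are the cosine of the angle between the two planes. *)
Let normr_det : `|det| = `|dot (fout f) e|.
Proof.
apply/eqP; rewrite -(@eqrXn2 _ 2)//; apply/eqP; rewrite !real_normK ?num_real//.
have c3 := fout_orthonormal f.
have [[ee b11 b22] [eb1 eb2 b12]] := eb.
have := orthonormal3_dot b1 b1 c3; have := orthonormal3_dot b2 b2 c3.
have := orthonormal3_dot b1 b2 c3.
have := orthonormal3_dot (fout f) (fout f) eb.
have [[cc _ _] _] := c3; rewrite cc b11 b22 b12 (dotC e) (dotC b1 (fout f)) (dotC b2 (fout f)).
rewrite -/t1 -/t2 (dotC t1 b1) (dotC t1 b2) (dotC t2 b1) (dotC t2 b2) /det.
set c0 := dot (fout f) e; set c1 := dot (fout f) b1; set c2 := dot (fout f) b2.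
set x11 := dot b1 t1; set x12 := dot b1 t2; set x21 := dot b2 t1; set x22 := dot b2 t2.
move=> h0 h12 h2 h1.
have e1 : x11 * x11 + x12 * x12 = 1 - c1 * c1 by lra.
have e2 : x21 * x21 + x22 * x22 = 1 - c2 * c2 by lra.
have e3 : x11 * x21 + x12 * x22 = - (c1 * c2) by lra.
(* Lagrange's identity: the squared determinant is the Gram determinant of the rows. *)
transitivity ((x11 * x11 + x12 * x12) * (x21 * x21 + x22 * x22)
   - (x11 * x21 + x12 * x22) ^+ 2); first by ring.
rewrite e1 e2 e3.
have -> : c0 ^+ 2 = 1 - c1 * c1 - c2 * c2 by rewrite expr2; lra.
by ring.
Qed.

Let pi := face_proj f e b1 b2.
(** The coordinates of [chart f p] along [b1] and [b2]; the linear part of this map has determinant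
    [det]. *)
Let A (p : plane) : plane := (dot b1 t1 * p.1 + dot b1 t2 * p.2 + dot b1 (forigin f),
  dot b2 t1 * p.1 + dot b2 t2 * p.2 + dot b2 (forigin f)).

Let A_scales : scales (leb2 R) A (leb2 R) `|dot (fout f) e|^-1.
Proof.
by rewrite -normr_det; apply: leb2_affine; rewrite -normr_eq0 normr_det normr_eq0.
Qed.

Let piA p : pi (A p) = chart f p.
Proof.
have baseA : base b1 b2 (A p) = chart f p - dot e (chart f p) *: e.
  rewrite {1}(orthonormal3_expand (chart f p) eb) -(addrA (dot e _ *: e)).
  rewrite addrAC subrr add0r /base /A /chart /=.
  by rewrite !dotDr !dotZr -/t1 -/t2; congr (_ *: _ + _ *: _); ring.
have [cc c1 c2] := fout_unit f.
have cchart : dot (fout f) (chart f p) = dot (fout f) (forigin f).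
  by rewrite /chart !dotDr !dotZr c1 c2 !mulr0 !addr0.
rewrite /pi /face_proj baseA [X in (X / _) *: _](_ : _ = dot e (chart f p) * dot (fout f) e).
  by rewrite mulfK// subrK.
by rewrite !dotBr dotZr cchart; ring.
Qed.

Lemma continuous_face_proj : continuous pi.
Proof.
have cb := @continuous_base b1 b2.
have cd : continuous (fun q : R * R => dot (fout f) (base b1 b2 q)).
  by move=> q; apply: continuous_comp; [exact: cb|exact: continuous_dotr].
have cs : continuous (fun q : R * R =>
    dot (fout f) (forigin f - base b1 b2 q) / dot (fout f) e).
  have -> : (fun q : R * R => dot (fout f) (forigin f - base b1 b2 q) / dot (fout f) e) =
    (fun q : R * R => (dot (fout f) (forigin f) - dot (fout f) (base b1 b2 q)) * (dot (fout f) e)^-1).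
    by apply/funext => q; rewrite dotBr.
  by move=> q; exact: (cvgM (cvgB (cvg_cst _) (cd q)) (cvg_cst _)).
by move=> q; apply: cvgD; [exact: cb|apply: cvgZr_tmp; exact: cs].
Qed.

Let pi_lty : (leb2 R (pi @^-1` fset f) < +oo)%E.
Proof.
apply: (scales_lty A_scales).
  exact: (measurable_param (@measurable_base_plane R) continuous_face_proj
    (@compact_fset R P f)).
have E : A @^-1` (pi @^-1` fset f) = chart f @^-1` fset f.
  by apply/seteqP; split => p; rewrite /preimage/= piA.
by have := face_lty f; rewrite -E.
Qed.

Lemma face_proj_integral (h : pt -> R) : {within fset f, continuous h} ->
  (leb2 R).-integrable setT (EFin \o (fun q => (h \_ (fset f)) (pi q))) /\
  \int[leb2 R]_q (h \_ (fset f)) (pi q) = `|dot (fout f) e| * int_face f h.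
Proof.
move=> ch; have hi := integrable_param_patch (@measurable_base_plane R)
  continuous_face_proj (@compact_fset R P f) pi_lty ch.
split; first exact: hi.
rewrite /int_face (Rintegral_patch (leb2 R) (chart f)).
have E : \int[leb2 R]_p (h \_ (fset f)) (pi (A p)) =
  `|dot (fout f) e|^-1 * \int[leb2 R]_q (h \_ (fset f)) (pi q).
  exact: (scales_integral A_scales hi).
have c0 : `|dot (fout f) e| != 0 by rewrite normr_eq0.
rewrite -[LHS]mul1r -(mulfV c0) -mulrA -E; congr (_ * _).
by apply: eq_Rintegral => p _; rewrite -piA.
Qed.

End Projection.
End Volume.

(** * The divergence theorem *)

Section RegionDivergence.
Context {R : realType} (P : polyhedron R).
Local Notation line := (measurableTypeR R).
Local Notation plane := (line * line)%type.
Local Notation space := (plane * line)%type.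
Local Notation pt := 'rV[R]_3.
Implicit Types (f : face P).

Section BadLines.
Variables e b1 b2 : pt.
Hypothesis eb : orthonormal3 e b1 b2.

(* The lines [q + R e] that lie in the plane of a face, resp. in a plane
   containing an edge and the direction [e]. *)
Let bad (i : face P + edge P) : set plane :=
  match i with
  | inl f => if dot (fout f) e == 0 then
      plane_line (dot (fout f) b1) (dot (fout f) b2) (dot (fout f) (forigin f))
    else set0
  | inr a => let w1 := dot b1 (vpos (etgt a) - vpos (esrc a)) in
             let w2 := dot b2 (vpos (etgt a) - vpos (esrc a)) in
    if (w1 == 0) && (w2 == 0) then plane_line 1 0 (dot b1 (vpos (esrc a)))
    else plane_line (- w2) w1
           (- w2 * dot b1 (vpos (esrc a)) + w1 * dot b2 (vpos (esrc a)))
  end.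

Definition bad_lines := \bigcup_i bad i.

Lemma bad_lines_null : measurable bad_lines /\ leb2 R bad_lines = 0%E.
Proof.
apply: null_bigcup => -[f|a] /=.
  case: eqP => [ce|_]; last by split; [exact: measurable0|exact: measure0].
  apply: plane_line_null; rewrite -negb_and; apply/negP => /andP[/eqP c1 /eqP c2].
  have [cc _ _] := fout_unit f.
  have := orthonormal3_dot (fout f) (fout f) eb.
  rewrite cc (dotC e) (dotC b1) (dotC b2) ce c1 c2 !mul0r !addr0 => /eqP.
  by rewrite oner_eq0.
(* An edge parallel to [e] projects to a single point, for which any line through it serves; the
   first branch takes a vertical one. *)
case: ifPn => [_|w0]; apply: plane_line_null; first by rewrite oner_neq0.
by rewrite oppr_eq0 orbC -negb_and.
Qed.

Variables (q : plane) (s : R).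
Hypothesis qN : ~ bad_lines q.
Let x := base b1 b2 q + s *: e.

Let b1x : dot b1 x = q.1.
Proof.
have [[_ b11 _] [eb1 _ b12]] := eb.
by rewrite !dotDr !dotZr b11 b12 (dotC b1) eb1; ring.
Qed.

Let b2x : dot b2 x = q.2.
Proof.
have [[_ _ b22] [_ eb2 b12]] := eb.
by rewrite !dotDr !dotZr b22 (dotC b2 b1) b12 (dotC b2) eb2; ring.
Qed.

Let no_edge (a : edge P) : ~ eset a x.
Proof.
move=> [r _ rx]; apply: qN; exists (inr a) => //=.
have := congr1 (dot b1) rx; have := congr1 (dot b2) rx.
rewrite b1x b2x !(dotDr (vpos (esrc a))) !dotZr => h2 h1.
case: ifPn => [/andP[/eqP w1 _]|_]; rewrite /plane_line /= -h1 -h2.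
  by rewrite w1; ring.
by ring.
Qed.

(** A line off [bad_lines] meets no edge, so [x] is relatively interior to every face containing it.
    Hence [fout_outward] applies, and [face_disjoint] leaves only one such face. *)
Lemma face_good_point :
  good_point (region P) [set: face P]%SET (@fset R P) (@fout R P) x.
Proof.
move=> f _ fx; have rx : relint (fnormal f) (fset f) x.
  apply: contrapT => nr; have : (fset f `\` relint (fnormal f) (fset f)) x by [].
  by rewrite face_boundary => -[a _ /no_edge].
split; first exact: fout_outward.
move=> g _ gx; apply: contrapT => /eqP gf.
have : (relint (fnormal f) (fset f) `&` fset g) x by [].
by rewrite face_disjoint// eq_sym.
Qed.

Lemma face_transverse f : fset f x -> dot (fout f) e != 0.
Proof.
move=> /fout_flat; rewrite dotBr => /subr0_eq fx; apply/eqP => ce.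
apply: qN; exists (inl f) => //=; rewrite ce eqxx /plane_line/= -fx.
by rewrite !dotDr !dotZr ce; ring.
Qed.

End BadLines.

Lemma region_divergence (k : 'I_3) (h g : pt -> R) :
  {within region P, continuous h} -> {within region P, continuous g} ->
  (forall (x : pt) (s : R), (region P)° (x + s *: delta_mx 0 k) ->
    is_derive s 1 ((fun s => h (x + s *: delta_mx 0 k)) : R -> R^o)
      (g (x + s *: delta_mx 0 k))) ->
  int_vol (region P) g = \sum_(f : face P) int_face f (fun x => h x * fout f 0 k).
Proof.
move=> ch cg hg; set e : pt := delta_mx 0 k.
have [b1 [b2 [sig [eb sigS sigE]]]] := @volume_frame R k.
have hi := integrable_param_patch (@measurable_base_space R) (@continuous_pt_of R)
  (@compact_region R P) (@vol_lty R P) cg.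
have hs := scales_integrable sigS hi.
pose F (p : space) := (g \_ (region P)) (pt_of (sig p)).
have intF : int_vol (region P) g = \int[leb3 R]_p F p.
  rewrite /int_vol (Rintegral_patch (leb3 R) (@pt_of R)).
  by have := scales_integral sigS hi; rewrite mul1r => ->.
have chf f : {within fset f, continuous h}.
  exact: (continuous_subspaceW (@fset_region R P f)) ch.
pose psi (f : face P) (q : plane) := Num.sg (dot (fout f) e) *
  (h \_ (fset f)) (face_proj f e b1 b2 q).
have psiP f : (leb2 R).-integrable setT (EFin \o psi f) /\
    \int[leb2 R]_q psi f q = int_face f (fun x => h x * fout f 0 k).
  have cke : dot (fout f) e = fout f 0 k.
    rewrite /dot (bigD1 k)//= !mxE !eqxx mulr1 big1 ?addr0// => i /negPf ik.
    by rewrite !mxE ik andbF mulr0.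
  rewrite -cke.
  have -> : int_face f (fun x => h x * dot (fout f) e) = dot (fout f) e * int_face f h.
    rewrite -(integral_onZ (integral_on_face f))//; congr (int_face _ _).
    by apply/funext => x; rewrite mulrC.
  (* For a face parallel to [e] the quotient in [face_proj] divides by 0, but then the sign factor
     and the flux are both 0. *)
  have [c0|c0] := eqVneq (dot (fout f) e) 0.
    have psi0 : psi f = cst 0 by apply/funext => q; rewrite /psi c0 sgr0 mul0r.
    rewrite psi0 c0 mul0r; split; first exact: integrable0.
    have -> : \int[leb2 R]_q (cst 0 q : R) = 0 * fine (leb2 R setT) by exact: Rintegral_cst.
    by rewrite mul0r.
  have [ih Eh] := face_proj_integral eb c0 (chf f).
  split; last by rewrite /psi RintegralZl// Eh mulrA -numEsg.
  rewrite (_ : _ \o _ = (fun q => (Num.sg (dot (fout f) e))%:E *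
    ((h \_ (fset f)) (face_proj f e b1 b2 q))%:E)%E)//.
  exact: integrableZl.
have [intPsi Psi] := Rintegral_sum (index_enum (face P)) (fun f _ => (psiP f).1)
  (Q := xpredT).
have section_integral q : ~ bad_lines e b1 b2 q ->
    \int[leb1 R]_s (g \_ (region P)) (base b1 b2 q + s *: e) = \sum_f psi f q.
  move=> qN; have [[ee _ _] _] := eb.
  rewrite -(Rintegral_patch (leb1 R) (fun s : line => base b1 b2 q + s *: e)).
  have -> : \sum_f psi f q = \sum_(f in [set: face P]%SET) psi f q.
    by apply: eq_bigl => f; rewrite finset.in_setT.
  apply: (@slice_ftc R (region P) 0 (face P) [set: face P]%SET (@fset R P)
    (@fout R P) (@forigin R P) (@compact_region R P)).
  - by move=> f _; exact: closed_fset.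
  - move=> x Dx; rewrite relint0 => nx.
    have : (region P `\` (region P)°) x by [].
    by rewrite region_boundary => -[f _ fx]; exists f; rewrite ?finset.in_setT.
  - by move=> f x _; exact: fout_flat.
  - by move=> f _; have [] := fout_unit f.
  - by move=> f _; rewrite dot0l.
  - exact: ee.
  - by rewrite dot0l.
  - exact: ch.
  - exact: cg.
  - by move=> s; rewrite relint0; exact: hg.
  - by move=> s; exact: (face_good_point eb qN).
  - by move=> s f _; exact: (face_transverse qN).
rewrite intF.
have [mN N0] := bad_lines_null eb.
have mPsi := (measurable_EFinP _ _).1 (measurable_int _ intPsi).
have -> : \int[leb3 R]_p F p = \int[leb2 R]_q \sum_f psi f q.
  apply: (@Rintegral_prod R _ _ _ _ (@leb2s R) (@lebesgue_measure R) F _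
    (bad_lines e b1 b2)).
  - exact: hs.
  - exact: mPsi.
  - exact: mN.
  - exact: N0.
  - move=> q qN; rewrite -(section_integral q qN).
    by apply: eq_Rintegral => s _; rewrite /F sigE.
rewrite Psi; apply: eq_bigr => f _; exact: (psiP f).2.
Qed.

End RegionDivergence.

(** * The divergence theorem on a face *)

Section FaceDivergence.
Context {R : realType} (P : polyhedron R).
Local Notation line := (measurableTypeR R).
Local Notation plane := (line * line)%type.
Local Notation pt := 'rV[R]_3.
Variable f : face P.

(* [d] is the direction of the slices *)
Variables d d' : pt.
Hypothesis tangents : (d = ftan2 f /\ d' = ftan1 f) \/ (d = ftan1 f /\ d' = ftan2 f).

Let ndd : orthonormal3 (fnormal f) d d'.
Proof.
by case: tangents => -[-> ->]; [apply: orthonormal3_perm|];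
  exact: face_orthonormal.
Qed.

Let fline (x : R) : pt := forigin f + x *: d'.

(** The inner variable has to run along [d]; when [d] is [ftan1 f] the two chart coordinates are
    exchanged. *)
Let face_sliced (g : pt -> R) : {within fset f, continuous g} ->
  (leb2 R).-integrable setT
    (EFin \o (fun p : plane => (g \_ (fset f)) (fline p.1 + p.2 *: d))) /\
  int_face f g = \int[leb2 R]_p (g \_ (fset f)) (fline p.1 + p.2 *: d).
Proof.
move=> cg; have hi := integrable_param_patch (@measurable_base_plane R)
  (@continuous_chart R P f) (@compact_fset R P f) (@face_lty R P f) cg.
rewrite /int_face (Rintegral_patch (leb2 R) (chart f)).
rewrite /fline; case: tangents => -[-> ->]; first by split; [exact: hi|].
pose G (p : plane) := (g \_ (fset f)) (forigin f + p.1 *: ftan2 f + p.2 *: ftan1 f).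
have E : G = (fun p => (g \_ (fset f)) (chart f (pswap p))).
  by apply/funext => -[x y]; rewrite /G /chart /pswap/= addrAC.
have hs := scales_integrable (@leb2_swap R) hi.
suff : (leb2 R).-integrable setT (EFin \o G) /\
  \int[leb2 R]_p (g \_ (fset f)) (chart f p) = \int[leb2 R]_p G p by [].
rewrite E; split; first exact: hs.
by have := scales_integral (@leb2_swap R) hi; rewrite mul1r => <-.
Qed.

Definition edge_proj (e : edge P) (x : R) : pt :=
  fline x + (dot (conormal f e) (vpos (esrc e) - fline x) / dot (conormal f e) d) *: d.

Section Projection.
Variable e : edge P.
Hypothesis ef : e \in fedges f.
Hypothesis cd : dot (conormal f e) d != 0.

(** In the plane of [f] both [d], [d'] and [etan e], [conormal f e] are orthonormal, so both squares
    complete that of [dot d (etan e)] to 1. *)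
Let normr_slope : `|dot d' (etan e)| = `|dot (conormal f e) d|.
Proof.
apply/eqP; rewrite -(@eqrXn2 _ 2)//; apply/eqP; rewrite !real_normK ?num_real//.
have o3 := edge_orthonormal ef.
have := orthonormal3_dot d d o3; have := orthonormal3_dot (etan e) (etan e) ndd.
have [[_ dd _] [nd _ _]] := ndd; have [[_ tt _] [nt _ _]] := o3.
by rewrite dd nd tt nt (dotC (etan e)) !expr2 => *; lra.
Qed.

Let A (r : line) : line := dot d' (etan e) * r + dot d' (vpos (esrc e) - forigin f).

Let A_scales : scales (leb1 R) A (leb1 R) `|dot (conormal f e) d|^-1.
Proof.
by rewrite -normr_slope; apply: leb1_affine; rewrite -normr_eq0 normr_slope normr_eq0.
Qed.

Let projA r : edge_proj e (A r) = epath e r.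
Proof.
have [[nn dd dd'] [nd nd' ddd']] := ndd.
have o3 := edge_orthonormal ef; have [[_ tt cc] [nt nc tc]] := o3.
set x := epath e r.
have nx : dot (fnormal f) (x - forigin f) = 0.
  have src : fset f (vpos (esrc e)).
    by apply: (eset_fset ef); exists 0; rewrite ?scale0r ?addr0//= in_itv/= lexx ler01.
  by rewrite /x /epath addrAC dotDr dotZr nt mulr0 addr0; exact: face_flat.
have AE : A r = dot d' (x - forigin f).
  by rewrite /A /x /epath addrAC [in RHS]dotDr dotZr; ring.
have lineA : fline (A r) = x - dot d (x - forigin f) *: d.
  have wE : dot d' (x - forigin f) *: d' = x - forigin f - dot d (x - forigin f) *: d.
    rewrite {2}(orthonormal3_expand (x - forigin f) ndd) nx scale0r add0r.
    by rewrite [RHS]addrAC subrr add0r.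
  by rewrite AE /fline wE addrA (addrC (forigin f)) subrK.
have cx : dot (conormal f e) x = dot (conormal f e) (vpos (esrc e)).
  by rewrite /x /epath dotDr dotZr (dotC _ (etan e)) tc mulr0 addr0.
rewrite /edge_proj lineA [X in (X / _) *: _](_ : _ = dot d (x - forigin f) * dot (conormal f e) d).
  by rewrite mulfK// subrK.
by rewrite !(dotBr _ _ (conormal f e)) (dotZr _ d) cx; ring.
Qed.

Let continuous_edge_proj : continuous (edge_proj e).
Proof.
have cl : continuous fline by exact: continuous_line.
have cdl : continuous (fun x : R => dot (conormal f e) (fline x)).
  by move=> q; apply: continuous_comp; [exact: cl|exact: continuous_dotr].
have cs : continuous (fun x : R =>
    dot (conormal f e) (vpos (esrc e) - fline x) / dot (conormal f e) d).
  have -> : (fun x : R => dot (conormal f e) (vpos (esrc e) - fline x) / dot (conormal f e) d) =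
    (fun x : R => (dot (conormal f e) (vpos (esrc e)) - dot (conormal f e) (fline x))
      * (dot (conormal f e) d)^-1).
    by apply/funext => q; rewrite dotBr.
  by move=> q; exact: (cvgM (cvgB (cvg_cst _) (cdl q)) (cvg_cst _)).
by move=> q; apply: cvgD; [exact: cl|apply: cvgZr_tmp; exact: cs].
Qed.

Let proj_lty : (leb1 R (edge_proj e @^-1` eset e) < +oo)%E.
Proof.
apply: (scales_lty A_scales).
  exact: (measurable_param (measurable_base_R R) continuous_edge_proj
    (@compact_eset R P e)).
have E : A @^-1` (edge_proj e @^-1` eset e) = epath e @^-1` eset e.
  by apply/seteqP; split => p; rewrite /preimage/= projA.
by have := edge_lty e; rewrite -E.
Qed.

Lemma edge_proj_integral (h : pt -> R) : {within eset e, continuous h} ->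
  (leb1 R).-integrable setT (EFin \o (fun x => (h \_ (eset e)) (edge_proj e x))) /\
  \int[leb1 R]_x (h \_ (eset e)) (edge_proj e x) =
    `|dot (conormal f e) d| * int_edge e h.
Proof.
move=> ch; have hi := integrable_param_patch (measurable_base_R R)
  continuous_edge_proj (@compact_eset R P e) proj_lty ch.
split; first exact: hi.
rewrite int_edgeE (Rintegral_patch (leb1 R) (epath e)).
have E : \int[leb1 R]_p (h \_ (eset e)) (edge_proj e (A p)) =
  `|dot (conormal f e) d|^-1 * \int[leb1 R]_q (h \_ (eset e)) (edge_proj e q).
  exact: (scales_integral A_scales hi).
have c0 : `|dot (conormal f e) d| != 0 by rewrite normr_eq0.
rewrite -[LHS]mul1r -(mulfV c0) -mulrA -E; congr (_ * _).
by apply: eq_Rintegral => p _; rewrite -projA.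
Qed.

End Projection.

(** Lines in the direction [d] through a vertex; a line containing an edge parallel to [d] is one of
    them. *)
Definition bad_abscissas : set line :=
  \bigcup_(n : vertex P) [set dot d' (vpos n - forigin f)].

Lemma bad_abscissas_null :
  measurable bad_abscissas /\ leb1 R bad_abscissas = 0%E.
Proof.
apply: null_bigcup => n; split; first exact: measurable_set1.
exact: lebesgue_measure_set1.
Qed.

Section GoodLine.
Variables (x s : R).
Hypothesis xN : ~ bad_abscissas x.
Let y := fline x + s *: d.

Let d'y : dot d' (y - forigin f) = x.
Proof.
have [[_ _ dd'] [_ _ ddd']] := ndd.
rewrite /y /fline -(addrA (forigin f)) addrAC subrr add0r dotDr !dotZr dd' (dotC d') ddd'.
by ring.
Qed.

Let no_vertex (n : vertex P) : y <> vpos n.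
Proof. by move=> yn; apply: xN; exists n => //=; rewrite -yn d'y. Qed.

(** Distinct edges meet only at end points, which the line avoids; at the remaining points of an
    edge the conormal is known to point outward. *)
Lemma edge_good_point :
  good_point (fset f) (fedges f) (@eset R P) (conormal f) y.
Proof.
move=> e ef ey; split.
  apply: (conormal_outward ef).
  by apply: eset_open_segment => //; exact: no_vertex.
move=> e' e'f e'y; apply: contrapT => /eqP ee'.
have := @edge_meet R P e e'; rewrite eq_sym ee' => /(_ isT y) [].
- by split.
- exact: no_vertex.
- exact: no_vertex.
Qed.

Lemma edge_transverse e : e \in fedges f -> eset e y ->
  dot (conormal f e) d != 0.
Proof.
move=> ef /esetP[r _ yr]; apply/eqP => cd.
have o3 := edge_orthonormal ef; have [[_ tt cc] [nt nc tc]] := o3.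
have td' : dot (etan e) d' = 0.
  have := orthonormal3_dot d d o3; have := orthonormal3_dot (etan e) (etan e) ndd.
  have [[_ dd _] [nd _ _]] := ndd.
  rewrite dd nd tt nt cd (dotC d (etan e)) (dotC d' (etan e)) => h1 h2.
  by apply/eqP; rewrite -sqrf_eq0 expr2; apply/eqP; lra.
apply: xN; exists (esrc e) => //=.
have := d'y; rewrite yr /epath => <-.
by rewrite !dotBr dotDr (dotZr r) (dotC d' (etan e)) td' mulr0 addr0.
Qed.

End GoodLine.

(** The argument for the region, one dimension lower: edges, conormals and vertices replace faces,
    outward normals and edges. *)
Lemma face_divergence (h g : pt -> R) :
  {within fset f, continuous h} -> {within fset f, continuous g} ->
  (forall (x : pt) (s : R), relint (fnormal f) (fset f) (x + s *: d) ->
    is_derive s 1 ((fun s => h (x + s *: d)) : R -> R^o) (g (x + s *: d))) ->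
  int_face f g =
  \sum_(e in fedges f) int_edge e (fun x => h x * dot (conormal f e) d).
Proof.
move=> ch cg hg.
have [hs intF] := face_sliced cg.
pose F (p : plane) := (g \_ (fset f)) (fline p.1 + p.2 *: d).
have che e : e \in fedges f -> {within eset e, continuous h}.
  by move=> ef; exact: (continuous_subspaceW (eset_fset ef)) ch.
pose psi (e : edge P) (x : line) := Num.sg (dot (conormal f e) d) *
  (h \_ (eset e)) (edge_proj e x).
have psiP e : e \in fedges f -> (leb1 R).-integrable setT (EFin \o psi e) /\
    \int[leb1 R]_x psi e x = int_edge e (fun x => h x * dot (conormal f e) d).
  move=> ef.
  have -> : int_edge e (fun x => h x * dot (conormal f e) d) =
      dot (conormal f e) d * int_edge e h.
    rewrite -(integral_onZ (integral_on_edge e))//; last exact: che.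
    by congr (int_edge _ _); apply/funext => x; rewrite mulrC.
  have [c0|c0] := eqVneq (dot (conormal f e) d) 0.
    have psi0 : psi e = cst 0 by apply/funext => q; rewrite /psi c0 sgr0 mul0r.
    rewrite psi0 c0 mul0r; split; first exact: integrable0.
    have -> : \int[leb1 R]_q (cst 0 q : R) = 0 * fine (leb1 R setT) by exact: Rintegral_cst.
    by rewrite mul0r.
  have [ih Eh] := edge_proj_integral ef c0 (che e ef).
  split; last by rewrite /psi RintegralZl// Eh mulrA -numEsg.
  rewrite (_ : _ \o _ = (fun q => (Num.sg (dot (conormal f e) d))%:E *
    ((h \_ (eset e)) (edge_proj e q))%:E)%E)//.
  exact: integrableZl.
have [intPsi Psi] := Rintegral_sum (index_enum (edge P)) (fun e ef => (psiP e ef).1)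
  (Q := fun e => e \in fedges f).
have section_integral x : ~ bad_abscissas x ->
    \int[leb1 R]_s (g \_ (fset f)) (fline x + s *: d) =
    \sum_(e in fedges f) psi e x.
  move=> xN; have [[nn dd _] [nd _ _]] := ndd.
  rewrite -(Rintegral_patch (leb1 R) (fun s : line => fline x + s *: d)).
  apply: (@slice_ftc R (fset f) (fnormal f) (edge P) (fedges f) (@eset R P)
    (conormal f) (fun e => vpos (esrc e)) (@compact_fset R P f)).
  - by move=> e _; exact: closed_eset.
  - move=> y Dy ny.
    have : (fset f `\` relint (fnormal f) (fset f)) y by [].
    by rewrite face_boundary => -[e ef ey]; exists e.
  - move=> e y ef /esetP[r _ ->]; rewrite /epath addrAC subrr add0r dotZr dotC.
    by have [_ [_ _ ->]] := edge_orthonormal ef; rewrite mulr0.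
  - by move=> e ef; have [[_ _ ->]] := edge_orthonormal ef.
  - by move=> e ef; have [_ [_ -> _]] := edge_orthonormal ef.
  - exact: dd.
  - exact: nd.
  - exact: ch.
  - exact: cg.
  - by move=> s; exact: edge_good_point.
  - by move=> s e; exact: edge_transverse.
rewrite intF.
have [mN N0] := bad_abscissas_null.
have mPsi := (measurable_EFinP _ _).1 (measurable_int _ intPsi).
have -> : \int[leb2 R]_p F p = \int[leb1 R]_x \sum_(e in fedges f) psi e x.
  apply: (@Rintegral_prod R _ _ _ _ (@lebesgue_measure R) (@lebesgue_measure R) F _
    bad_abscissas).
  - exact: hs.
  - exact: mPsi.
  - exact: mN.
  - exact: N0.
  - by move=> x xN; rewrite -(section_integral x xN).
rewrite Psi; apply: eq_bigr => e ef; exact: (psiP e ef).2.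
Qed.

End FaceDivergence.

(** * Derivatives along lines and polynomials *)

Section Gradient.
Context {R : realType}.
Local Notation pt := 'rV[R]_3.

Lemma has_gradient_continuous (D : set pt) (v : pt -> R) :
  (forall x, D x -> exists G, has_gradient D v x G) -> {within D, continuous v}.
Proof.
move=> vD; apply/subspace_continuousP => x Dx.
have [G HG] := vD x Dx.
apply/cvgrPdist_lt => eps eps0.
(* Accuracy 1 in [has_gradient], together with [dot_norm_le], makes [1 + 3 * |G|] a local Lipschitz
   constant of [v] at [x]. *)
have M0 : 0 < 1 + 3 * `|G| by rewrite ltr_pwDl// mulr_ge0.
have r0 : 0 < eps / (1 + 3 * `|G|) by exact: divr_gt0.
have near_ball : \forall y \near within D (nbhs x), `|x - y| < eps / (1 + 3 * `|G|).
  by apply: cvg_within; have := nbhsx_ballx x _ r0; rewrite -ball_normE.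
apply: filterS2 near_ball (HG 1 ltr01) => y yx; rewrite mul1r => Hy.
rewrite distrC; apply: (@le_lt_trans _ _ ((1 + 3 * `|G|) * `|y - x|)).
  rewrite mulrDl mul1r -[v y - v x](subrK (dot G (y - x))).
  by apply: (le_trans (ler_normD _ _)); apply: lerD => //; exact: dot_norm_le.
by rewrite mulrC -ltr_pdivlMr// distrC.
Qed.

(** The relative gradient is tested only at points of [D], so the line has to remain in [D] near
    [s]. The point itself may lie on the boundary of [D], as it does for lines inside a face or
    along an edge. *)
Lemma has_gradient_line (D : set pt) (v : pt -> R) (x e G : pt) (s : R) :
  has_gradient D v (x + s *: e) G -> D (x + s *: e) ->
  (\forall t \near s, D (x + t *: e)) ->
  is_derive s 1 ((fun t => v (x + t *: e)) : R -> R^o) (dot G e).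
Proof.
move=> HG Ds Dt.
have lim : h^-1 *: (v (x + (h + s) *: e) - v (x + s *: e) : R^o) @[h --> 0^'] --> dot G e.
  apply/cvgrPdist_le => eps eps0.
  (* [1 +] guards against division by zero when [e] vanishes. *)
  have e1 : 0 < 1 + `|e| by rewrite ltr_pwDl.
  have r0 : 0 < eps / (1 + `|e|) by exact: divr_gt0.
  have sh : h + s @[h --> (0 : R)] --> s.
    by rewrite -[X in _ --> X]add0r; apply: cvgD; [exact: cvg_id|exact: cvg_cst].
  have lh : x + (h + s) *: e @[h --> (0 : R)] --> x + s *: e.
    apply: cvgD; first exact: cvg_cst.
    by apply: cvgZr_tmp.
  have H1 : \forall h \near (0 : R), D (x + (h + s) *: e) by exact: (sh _ Dt).
  have H2 : \forall h \near (0 : R), D (x + (h + s) *: e) ->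
      `|v (x + (h + s) *: e) - v (x + s *: e) - dot G (x + (h + s) *: e - (x + s *: e))|
      <= eps / (1 + `|e|) * `|x + (h + s) *: e - (x + s *: e)|.
    exact: (lh _ (HG _ r0)).
  have H3 : \forall h \near (0 : R)^', h != 0 by exact: nbhs_dnbhs_neq.
  apply: filterS3 H3 (nbhs_dnbhs H1) (nbhs_dnbhs H2) => h h0 Dh /(_ Dh).
  have -> : x + (h + s) *: e - (x + s *: e) = h *: e.
    by rewrite opprD addrACA subrr add0r -scalerBl addrK.
  rewrite dotZr normrZ => Hh.
  have nh : 0 < `|h| by rewrite normr_gt0.
  rewrite -(ler_pM2l nh) -normrM mulrBr [h * (_ *: _)]mulVKf//.
  rewrite distrC; apply: (le_trans Hh).
  rewrite mulrCA ler_pM2l// mulrAC ler_pdivrMr// ler_pM2l//.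
  by rewrite lerDr ler01.
have E : (fun h : R => h^-1 *: (((fun t => v (x + t *: e)) \o shift s) (h *: (1 : R)) -
    v (x + s *: e) : R^o)) = (fun h : R => h^-1 *: (v (x + (h + s) *: e) - v (x + s *: e) : R^o)).
  by apply/funext => h /=; rewrite /shift /= /(_ *: _) /= mulr1.
split.
  by rewrite /derivable E; apply/cvg_ex; exists (dot G e).
by rewrite /derive E; apply/cvg_lim.
Qed.

End Gradient.

Section Poly3.
Context {R : realType}.
Local Notation pt := 'rV[R]_3.
Variable k : nat.
Implicit Types (p q : pt -> R).

Lemma poly3D p q : poly3 k p -> poly3 k q -> poly3 k (fun x => p x + q x).
Proof.
move=> [c ->] [d ->]; exists (fun m => c m + d m); apply/funext => x.
by rewrite -big_split; apply: eq_bigr => m _; rewrite mulrDl.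
Qed.

Lemma poly3Z (a : R) p : poly3 k p -> poly3 k (fun x => a * p x).
Proof.
move=> [c ->]; exists (fun m => a * c m); apply/funext => x.
by rewrite mulr_sumr; apply: eq_bigr => m _; rewrite mulrA.
Qed.

Lemma poly3Zr (a : R) p : poly3 k p -> poly3 k (fun x => p x * a).
Proof.
move=> /(poly3Z a); congr (poly3 k _).
by apply/funext => x; rewrite mulrC.
Qed.

Lemma poly3N p : poly3 k p -> poly3 k (fun x => - p x).
Proof.
move=> /(poly3Z (-1)); rewrite (_ : (fun x => -1 * p x) = fun x => - p x)//.
by apply/funext => x; rewrite mulN1r.
Qed.

Lemma poly3_sum (I : Type) (r : seq I) (Q : pred I) (f : I -> pt -> R) :
  (forall i, Q i -> poly3 k (f i)) -> poly3 k (fun x => \sum_(i <- r | Q i) f i x).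
Proof.
move=> fP; elim: r => [|i r IH].
  rewrite [X in poly3 k X](_ : _ = fun=> 0); first exact: poly0.
  by apply/funext => x; rewrite big_nil.
have [Qi|Qi] := boolP (Q i).
  rewrite [X in poly3 k X](_ : _ = fun x => f i x + \sum_(j <- r | Q j) f j x).
    by apply: poly3D => //; exact: fP.
  by apply/funext => x; rewrite big_cons Qi.
rewrite [X in poly3 k X](_ : _ = fun x => \sum_(j <- r | Q j) f j x)//.
by apply/funext => x; rewrite big_cons (negPf Qi).
Qed.

Definition monomial (a b c : nat) (x : pt) : R :=
  x 0 0 ^+ a * x 0 1 ^+ b * x 0 2%:R ^+ c.

Lemma prod3E (f : 'I_3 -> R) : \prod_i f i = f 0 * f 1 * f 2%:R.
Proof.
rewrite !big_ord_recl big_ord0 mulr1 mulrA.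
by congr (_ * _ * _); congr (f _); apply/val_inj.
Qed.

Lemma sum3E (f : 'I_3 -> nat) : (\sum_i f i = f 0%R + f 1%R + f 2%:R%R)%N.
Proof.
rewrite !big_ord_recl big_ord0 addn0 addnA.
by congr (_ + _ + _)%N; congr (f _); apply/val_inj.
Qed.

Lemma poly3_monomial a b c : (a + b + c <= k)%N -> poly3 k (monomial a b c).
Proof.
move=> abck.
pose m0 : {ffun 'I_3 -> 'I_k.+1} := [ffun i : 'I_3 => inord (nth 0%N [:: a; b; c] i)].
have m0E : [/\ m0 0 = a :> nat, m0 1 = b :> nat & m0 2%:R = c :> nat].
  rewrite /m0 !ffunE /= !inordK ?ltnS//.
  - by apply: leq_trans abck; rewrite leq_addl.
  - by apply: leq_trans abck; rewrite -addnA addnCA leq_addr.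
  - by apply: leq_trans abck; rewrite -addnA leq_addr.
have [a0 b0 c0] := m0E.
exists (fun m => (m == m0)%:R); apply/funext => x.
rewrite (bigD1 m0)/=; last by rewrite sum3E a0 b0 c0.
rewrite eqxx mul1r [X in _ = _ + X]big1 ?addr0; first by rewrite prod3E a0 b0 c0.
by move=> m /andP[_ /negPf ->]; rewrite mul0r.
Qed.

Lemma poly3_ind (Q : (pt -> R) -> Prop) : Q (fun=> 0) ->
  (forall p q, Q p -> Q q -> Q (fun x => p x + q x)) ->
  (forall a p, Q p -> Q (fun x => a * p x)) ->
  (forall a b c, (a + b + c <= k)%N -> Q (monomial a b c)) ->
  forall p, poly3 k p -> Q p.
Proof.
move=> Q0 QD QZ Qm p [c ->].
elim: (index_enum _) => [|m r IH].
  rewrite [X in Q X](_ : _ = fun=> 0)//.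
  by apply/funext => x; rewrite big_nil.
have [mk|mk] := boolP (\sum_i m i <= k)%N.
  rewrite [X in Q X](_ : _ = fun x : pt => c m * monomial (m 0) (m 1) (m 2%:R) x +
    \sum_(j <- r | (\sum_i j i <= k)%N) c j * \prod_i x 0 i ^+ j i).
    by apply: QD => //; apply: QZ; apply: Qm; rewrite sum3E in mk.
  by apply/funext => x; rewrite big_cons mk prod3E.
rewrite [X in Q X](_ : _ = fun x : pt =>
  \sum_(j <- r | (\sum_i j i <= k)%N) c j * \prod_i x 0 i ^+ j i)//.
by apply/funext => x; rewrite big_cons (negPf mk).
Qed.

Lemma is_derive_coord (x v : pt) (i : 'I_3) :
  is_derive x v ((fun y : pt => y 0 i) : pt -> R^o) (v 0 i).
Proof.
have lim : h^-1 *: ((((fun y : pt => y 0 i) : pt -> R^o) \o shift x) (h *: v) - x 0 i : R^o)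
    @[h --> 0^'] --> v 0 i.
  apply: cvg_near_cst; near=> h.
  have h0 : h != 0 by near: h; exact: nbhs_dnbhs_neq.
  by rewrite /= /shift !mxE addrK [LHS]mulKf.
split; first by apply/cvg_ex; exists (v 0 i).
exact/cvg_lim.
Unshelve. all: by end_near. Qed.

(** An exponent 0 has predecessor 0, which is harmless because its factor is 0. *)
Lemma is_derive_monomial a b c (x v : pt) :
  is_derive x v (monomial a b c : pt -> R^o)
   (v 0 0 * (a%:R * monomial a.-1 b c x) + v 0 1 * (b%:R * monomial a b.-1 c x)
     + v 0 2%:R * (c%:R * monomial a b c.-1 x)).
Proof.
have h0 := is_derive_coord x v 0.
have h1 := is_derive_coord x v 1.
have h2 := is_derive_coord x v 2%:R.
have E : (monomial a b c : pt -> R^o) =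
  ((fun y : pt => y 0 0) : pt -> R^o) ^+ a * ((fun y : pt => y 0 1) : pt -> R^o) ^+ b *
  ((fun y : pt => y 0 2%:R) : pt -> R^o) ^+ c.
  by apply/funext => y; rewrite /monomial !mulrfctE !exprfctE.
rewrite E; apply: is_derive_eq.
have scaleE (r t : R) : r *: (t : R^o) = r * t by [].
rewrite !mulrfctE !exprfctE /monomial !scaleE.
by ring.
Qed.

Lemma continuous_monomial a b c : continuous (monomial a b c).
Proof.
have ce (i : 'I_3) n : continuous (fun y : pt => y 0 i ^+ n).
  by move=> x; exact: (@continuous_comp _ _ _ (fun y : pt => y 0 i) (fun t => t ^+ n) x
    (@continuous_coord R i x) (@exprn_continuous _ n _)).
by move=> x; exact: (cvgM (cvgM (@ce 0 a x) (@ce 1 b x)) (@ce 2%:R c x)).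
Qed.

Lemma poly3_continuous p : poly3 k p -> continuous p.
Proof.
apply: (@poly3_ind (fun p => continuous p)).
- by move=> x; exact: cst_continuous.
- by move=> q r cq cr x; exact: (cvgD (cq x) (cr x)).
- by move=> a q cq x; exact: (cvgM (cvg_cst _) (cq x)).
- by move=> a b c _; exact: continuous_monomial.
Qed.

Lemma is_derive_pd p (x v D : pt) :
  (forall v, is_derive x v (p : pt -> R^o) (dot D v)) -> grad p x = D.
Proof.
move=> h; apply/rowP => i; rewrite mxE /pd.
have [_ ->] := h (delta_mx 0 i).
rewrite /dot (bigD1 i)//= !mxE !eqxx mulr1 big1 ?addr0// => j /negPf ji.
by rewrite !mxE ji andbF mulr0.
Qed.

(** The induction on monomials is run for some polynomial field [D] representing all directional
    derivatives; the coordinate directions then identify [D] with [grad p]. *)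
Lemma poly3_derive p : poly3 k p ->
  (forall x v, is_derive x v (p : pt -> R^o) (dot (grad p x) v)) /\
  (forall i, poly3 k (pd i p)).
Proof.
suff : poly3 k p -> exists D : pt -> pt,
  (forall x v, is_derive x v (p : pt -> R^o) (dot (D x) v)) /\
  (forall i, poly3 k (fun x => D x 0 i)).
  move=> H /H [D [dD DP]].
  have gD x : grad p x = D x by exact: is_derive_pd.
  split => [x v|i]; first by rewrite gD.
  rewrite (_ : pd i p = fun x => D x 0 i)//.
  by apply/funext => x; rewrite -gD mxE.
apply: (@poly3_ind (fun p => exists D : pt -> pt,
  (forall x v, is_derive x v (p : pt -> R^o) (dot (D x) v)) /\
  (forall i, poly3 k (fun x => D x 0 i)))).
- exists (fun=> 0); split => [x v|i]; first by rewrite dot0l; exact: is_derive_cst.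
  rewrite [X in poly3 k X](_ : _ = fun=> 0); first exact: poly0.
  by apply/funext => x; rewrite mxE.
- move=> q r [D [dD DP]] [E [dE EP]]; exists (fun x => D x + E x).
  split => [x v|i]; first by rewrite dotDl; exact: is_deriveD.
  rewrite [X in poly3 k X](_ : _ = fun x => D x 0 i + E x 0 i); first exact: poly3D.
  by apply/funext => x; rewrite mxE.
- move=> a q [D [dD DP]]; exists (fun x => a *: D x).
  split => [x v|i].
    by rewrite dotZl; exact: is_deriveZ.
  rewrite [X in poly3 k X](_ : _ = fun x => a * D x 0 i); first exact: poly3Z.
  by apply/funext => x; rewrite mxE.
- move=> a b c abck; exists (fun x => vec3 (a%:R * monomial a.-1 b c x)
    (b%:R * monomial a b.-1 c x) (c%:R * monomial a b c.-1 x)).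
  split => [x v|i].
    apply: is_derive_eq; first exact: is_derive_monomial.
    by rewrite dotE vec30 vec31 vec32; ring.
  have pred_le (m n : nat) : (m <= n)%N -> (m.-1 <= n)%N.
    by move=> mn; apply: leq_trans mn; exact: leq_pred.
  case: i => -[|[|[|//]]] hi.
  + rewrite [X in poly3 k X](_ : _ = fun x => a%:R * monomial a.-1 b c x).
      apply: poly3Z; apply: poly3_monomial; apply: leq_trans abck.
      by rewrite !leq_add2r leq_pred.
    by apply/funext => x; rewrite mxE.
  + rewrite [X in poly3 k X](_ : _ = fun x => b%:R * monomial a b.-1 c x).
      apply: poly3Z; apply: poly3_monomial; apply: leq_trans abck.
      by rewrite leq_add2r leq_add2l leq_pred.
    by apply/funext => x; rewrite mxE.
  + rewrite [X in poly3 k X](_ : _ = fun x => c%:R * monomial a b c.-1 x).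
      apply: poly3Z; apply: poly3_monomial; apply: leq_trans abck.
      by rewrite leq_add2l leq_pred.
    by apply/funext => x; rewrite mxE.
Qed.

Lemma poly3_pd p i : poly3 k p -> poly3 k (pd i p).
Proof. by move=> /poly3_derive[]. Qed.

Lemma is_derive_line p (x e : pt) (s : R) : poly3 k p ->
  is_derive s 1 ((fun t => p (x + t *: e)) : R -> R^o)
    (dot (grad p (x + s *: e)) e).
Proof.
move=> /poly3_derive[+ _] => /(_ (x + s *: e) e) [dp Dp].
have E : (fun h : R => h^-1 *: (((fun t => p (x + t *: e)) \o shift s) (h *: (1 : R)) -
    p (x + s *: e) : R^o)) = (fun h : R => h^-1 *: (((p : pt -> R^o) \o shift (x + s *: e)) (h *: e) -
    p (x + s *: e) : R^o)).
  apply/funext => h /=; rewrite /shift /=.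
  have -> : h *: (1 : R) + s = h + s by rewrite /(_ *: _) /= mulr1.
  by rewrite scalerDl addrCA addrA.
by split; [rewrite /derivable E|rewrite /derive E].
Qed.

End Poly3.

(** * Existence of the projections *)

Section Projection.
Context {R : realType}.
Local Notation pt := 'rV[R]_3.
Variables (D : set pt) (integ : (pt -> R) -> R).
Hypothesis integD : integral_on D integ.

Lemma integral_on_sum n (f : 'I_n -> pt -> R) : (forall i, {within D, continuous (f i)}) ->
  integ (fun x => \sum_i f i x) = \sum_i integ (f i).
Proof.
have integ0 : integ (fun=> 0) = 0.
  have := integral_onZ integD 0 (@within_continuous_cst R pt D 0).
  by rewrite (mul0r 0) mul0r.
move=> cf; elim: (index_enum _) => [|i r IH].
  rewrite big_nil -[RHS]integ0; congr integ.
  by apply/funext => x; rewrite big_nil.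
rewrite big_cons -IH -(integral_onD integD)//.
  by congr integ; apply/funext => x; rewrite big_cons.
by apply: within_continuous_sum => j _; exact: cf.
Qed.

(* A continuous function of vanishing square integral is orthogonal to
   everything: expand the square of [v - t z] and let [t] vary. *)
Let integ_null (v z : pt -> R) : {within D, continuous v} ->
  {within D, continuous z} -> integ (fun x => z x * z x) = 0 ->
  integ (fun x => v x * z x) = 0.
Proof.
move=> cv cz zz; apply/eqP; apply: contraT => vz.
have cvv := within_continuousM cv cv; have cvz := within_continuousM cv cz.
have czz := within_continuousM cz cz.
have H t : 0 <= integ (fun x => v x * v x) - 2 * t * integ (fun x => v x * z x).
  have := integral_on_ge0 integD (f := fun x => (v x - t * z x) ^+ 2)
    (fun x _ => sqr_ge0 _).
  have -> : (fun x => (v x - t * z x) ^+ 2) = (fun x => v x * v x +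
      ((- (2 * t)) * (v x * z x) + t ^+ 2 * (z x * z x))).
    by apply/funext => x; ring.
  rewrite (integral_onD integD)//; last first.
    by apply: within_continuousD; apply: within_continuousM => //;
      exact: within_continuous_cst.
  rewrite (integral_onD integD); last 2 first.
  - by apply: within_continuousM => //; exact: within_continuous_cst.
  - by apply: within_continuousM => //; exact: within_continuous_cst.
  by rewrite !(integral_onZ integD)// zz mulr0 addr0 mulNr.
(* For this value of [t] the right-hand side of [H] is -1. *)
have := H ((integ (fun x => v x * v x) + 1) / (2 * integ (fun x => v x * z x))).
rewrite (_ : 2 * _ * _ = integ (fun x => v x * v x) + 1); first by lra.
by field.
Qed.

(** The [b i] may be dependent on [D], so the Gram matrix [A] may be singular. A vector [w] with
    [A w = 0] gives a combination of the [b i] of vanishing square integral, to which [v] is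
    orthogonal by [integ_null]; hence [r] lies in the row space of [A]. *)
Lemma gram_solvable n (b : 'I_n -> pt -> R) (v : pt -> R) :
  (forall i, {within D, continuous (b i)}) -> {within D, continuous v} ->
  exists c : 'I_n -> R, forall j,
    integ (fun x => (\sum_i c i * b i x) * b j x) = integ (fun x => v x * b j x).
Proof.
move=> cb cv.
pose A : 'M[R]_n := \matrix_(i, j) integ (fun x => b i x * b j x).
pose r : 'rV[R]_n := \row_j integ (fun x => v x * b j x).
have integ_lin (f : pt -> R) (c : 'I_n -> R) : {within D, continuous f} ->
    integ (fun x => f x * \sum_i c i * b i x) = \sum_i c i * integ (fun x => f x * b i x).
  move=> cf; rewrite (_ : (fun x => _) = fun x => \sum_i c i * (f x * b i x)); last first.
    apply/funext => x; rewrite mulr_sumr; apply: eq_bigr => i _; ring.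
  rewrite integral_on_sum => [|i].
    apply: eq_bigr => i _; rewrite (integral_onZ integD)//.
    exact: within_continuousM.
  by apply: within_continuousM;
    [exact: within_continuous_cst|exact: within_continuousM].
have cz (c : 'I_n -> R) : {within D, continuous (fun x => \sum_i c i * b i x)}.
  apply: within_continuous_sum => i _.
  by apply: within_continuousM => //; exact: within_continuous_cst.
have : (r <= A)%MS.
  rewrite submxE; apply/eqP/rowP => j; rewrite mxE [RHS]mxE.
  pose w i := cokermx A i j.
  transitivity (integ (fun x => v x * \sum_i w i * b i x)).
    by rewrite integ_lin//; apply: eq_bigr => i _; rewrite mxE mulrC.
  apply: integ_null => //.
  rewrite integ_lin// big1// => i _.
  rewrite (_ : integ _ = (A *m cokermx A) i j); first by rewrite mulmx_coker mxE mulr0.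
  rewrite mxE (_ : (fun x => _) = fun x => b i x * \sum_i w i * b i x); last first.
    by apply/funext => x; rewrite mulrC.
  by rewrite integ_lin//; apply: eq_bigr => l _; rewrite mxE mulrC.
move=> /submxP[c rc]; exists (fun i => c 0 i) => j.
have := congr1 (fun M : 'rV_n => M 0 j) rc; rewrite !mxE => ->.
rewrite (_ : (fun x => _) = fun x => b j x * \sum_i c 0 i * b i x); last first.
  by apply/funext => x; rewrite mulrC.
rewrite integ_lin//; apply: eq_bigr => i _; rewrite mxE; congr (_ * integ _).
by apply/funext => x; rewrite mulrC.
Qed.

Lemma proj_poly3E (k : nat) (v : pt -> R) : {within D, continuous v} ->
  forall phi, poly3 k phi ->
  integ (fun x => Defs.proj integ D (poly3 k) v x * phi x) = integ (fun x => v x * phi x).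
Proof.
(* If nothing satisfied the defining condition, [get] would return its default; a solution of the
   normal equations for the monomials, cut off outside [D], contradicts this. *)
move=> cv; rewrite /Defs.proj; case: xgetP => [q _ [_ //]|noq] phi _; exfalso.
pose I := {ffun 'I_3 -> 'I_k.+1}.
(* Monomials of too high a degree are replaced by 0, so that sums run over the whole index type. *)
pose b (m : I) (x : pt) : R :=
  if (\sum_i m i <= k)%N then \prod_i x 0 i ^+ m i else 0.
have polyb (c : I -> R) : poly3 k (fun x => \sum_m c m * b m x).
  exists c; apply/funext => x; rewrite [RHS]big_mkcond; apply: eq_bigr => m _.
  by rewrite /b; case: ifP => // _; rewrite mulr0.
have cpoly p : poly3 k p -> {within D, continuous p}.
  by move=> /poly3_continuous cp; exact: continuous_subspaceT.
have cb m : {within D, continuous (b m)}.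
  apply: cpoly; have := polyb (fun m' => (m' == m)%:R); congr (poly3 k _).
  apply/funext => x; rewrite (bigD1 m)//= eqxx mul1r big1 ?addr0// => i /negPf ->.
  by rewrite mul0r.
have [c Hc] := gram_solvable (fun j : 'I_#|{: I}| => cb (enum_val j)) cv.
have sumE (F : I -> R) : \sum_(j : 'I_#|{: I}|) F (enum_val j) = \sum_m F m.
  by rewrite [RHS](reindex (@enum_val _ (mem {: I})))//; apply: onW_bij; exact: enum_val_bij.
pose c' m := c (enum_rank m).
pose q x := \sum_m c' m * b m x.
have qE x : q x = \sum_i c i * b (enum_val i) x.
  by rewrite /q -sumE; apply: eq_bigr => i _; rewrite /c' enum_valK.
apply: (noq (q \_ D)); split; first by exists q => //; exact: polyb.
move=> psi [d ->].
transitivity (integ (fun x => q x * \sum_m d m * b m x)).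
  apply: (eq_integral_on integD) => x Dx; rewrite patchE mem_set//; congr (_ * _).
  rewrite big_mkcond; apply: eq_bigr => m _.
  by rewrite /b; case: ifP => // _; rewrite mulr0.
transitivity (integ (fun x => v x * \sum_m d m * b m x)); last first.
  apply: (eq_integral_on integD) => x Dx; congr (_ * _).
  rewrite [RHS]big_mkcond; apply: eq_bigr => m _.
  by rewrite /b; case: ifP => // _; rewrite mulr0.
have expand (f : pt -> R) : {within D, continuous f} ->
    integ (fun x => f x * \sum_m d m * b m x) =
    \sum_(j : 'I_#|{: I}|) d (enum_val j) * integ (fun x => f x * b (enum_val j) x).
  move=> cf.
  rewrite (_ : (fun x => _) = fun x => \sum_(j : 'I_#|{: I}|)
      d (enum_val j) * (f x * b (enum_val j) x)); last first.
    apply/funext => x; rewrite -(sumE (fun m => d m * b m x)) mulr_sumr.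
    by apply: eq_bigr => i _; ring.
  rewrite integral_on_sum => [|i].
    apply: eq_bigr => i _; rewrite (integral_onZ integD)//.
    exact: within_continuousM.
  by apply: within_continuousM;
    [exact: within_continuous_cst|exact: within_continuousM].
rewrite !expand//; last by apply: cpoly; exact: polyb.
apply: eq_bigr => j _; congr (_ * _); rewrite -Hc; congr integ.
by apply/funext => x; rewrite qE.
Qed.

End Projection.

(** * Green's formulas *)

Section VectorCalculus.
Context {R : realType}.
Local Notation pt := 'rV[R]_3.

Lemma dot_cross_cross (n w u : pt) : dot n n = 1 -> dot n u = 0 ->
  dot (cross n (cross w n)) u = dot w u.
Proof.
rewrite !dotE => nn nu; rewrite /cross !(vec30, vec31, vec32).
transitivity ((n 0 0 * n 0 0 + n 0 1 * n 0 1 + n 0 2%:R * n 0 2%:R) *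
    (w 0 0 * u 0 0 + w 0 1 * u 0 1 + w 0 2%:R * u 0 2%:R) -
  (n 0 0 * w 0 0 + n 0 1 * w 0 1 + n 0 2%:R * w 0 2%:R) *
    (n 0 0 * u 0 0 + n 0 1 * u 0 1 + n 0 2%:R * u 0 2%:R)); first by ring.
by rewrite nn nu mulr0 subr0 mul1r.
Qed.

Lemma dot_crossl (u v w : pt) : dot (cross u v) w = dot u (cross v w).
Proof. by rewrite !dotE /cross !(vec30, vec31, vec32); ring. Qed.

Lemma dot_cross_self (u n : pt) : dot n (cross u n) = 0.
Proof. by rewrite !dotE /cross !(vec30, vec31, vec32); ring. Qed.

(* Crossing twice with a unit vector [n] is minus the projection onto the
   plane orthogonal to [n]. *)
Lemma cross_iter4 (n u : pt) : dot n n = 1 -> dot n u = 0 ->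
  cross (cross (cross (cross u n) n) n) n = u.
Proof.
move=> nn nu.
have cross2 w : dot n w = 0 -> cross (cross w n) n = - w.
  rewrite dotE => nw; have := nn; rewrite dotE => nn'.
  apply: pt_ext; rewrite /cross !(vec30, vec31, vec32) !mxE.
  - transitivity (n 0 0 * (n 0 0 * w 0 0 + n 0 1 * w 0 1 + n 0 2%:R * w 0 2%:R) -
      (n 0 0 * n 0 0 + n 0 1 * n 0 1 + n 0 2%:R * n 0 2%:R) * w 0 0); first by ring.
    by rewrite nw nn' mulr0 mul1r sub0r.
  - transitivity (n 0 1 * (n 0 0 * w 0 0 + n 0 1 * w 0 1 + n 0 2%:R * w 0 2%:R) -
      (n 0 0 * n 0 0 + n 0 1 * n 0 1 + n 0 2%:R * n 0 2%:R) * w 0 1); first by ring.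
    by rewrite nw nn' mulr0 mul1r sub0r.
  - transitivity (n 0 2%:R * (n 0 0 * w 0 0 + n 0 1 * w 0 1 + n 0 2%:R * w 0 2%:R) -
      (n 0 0 * n 0 0 + n 0 1 * n 0 1 + n 0 2%:R * n 0 2%:R) * w 0 2%:R); first by ring.
    by rewrite nw nn' mulr0 mul1r sub0r.
by rewrite !cross2 ?opprK// dotNr nu oppr0.
Qed.

Lemma crossDZ (n u v : pt) (a b : R) :
  cross n (a *: u + b *: v) = a *: cross n u + b *: cross n v.
Proof. by apply: pt_ext; rewrite /cross !(mxE, vec30, vec31, vec32) /=; ring. Qed.

Lemma cross_self (n : pt) : cross n n = 0.
Proof. by apply: pt_ext; rewrite /cross !(vec30, vec31, vec32) !mxE; ring. Qed.

Lemma dot_delta (u : pt) i : dot u (delta_mx 0 i) = u 0 i.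
Proof.
rewrite /dot (bigD1 i)//= !mxE !eqxx mulr1 big1 ?addr0// => j /negPf ji.
by rewrite !mxE ji andbF mulr0.
Qed.

(** Expand [delta_mx 0 i] in the frame: its component along [n] disappears in the cross product with
    [n]. *)
Lemma orthonormal3_cross (n t1 t2 : pt) (i : 'I_3) : orthonormal3 n t1 t2 ->
  t1 0 i *: cross n t1 + t2 0 i *: cross n t2 = cross n (delta_mx 0 i).
Proof.
move=> o3; rewrite -crossDZ.
have := orthonormal3_expand (delta_mx 0 i) o3; rewrite !dot_delta -addrA => E.
have := crossDZ n n (t1 0 i *: t1 + t2 0 i *: t2) (n 0 i) 1.
by rewrite !scale1r cross_self scaler0 add0r -E => ->.
Qed.

Section Poly.
Variable k : nat.

Lemma poly3_dot (u : pt -> pt) (w : pt) : vpoly k u -> poly3 k (fun x => dot (u x) w).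
Proof.
move=> uP; rewrite /dot; apply: poly3_sum => i _.
by apply: poly3Zr; exact: uP.
Qed.

Lemma poly3_div (u : pt -> pt) : vpoly k u -> poly3 k (div u).
Proof. by move=> uP; apply: poly3_sum => i _; apply: poly3_pd; exact: uP. Qed.

Lemma poly3_curl (u : pt -> pt) (w : pt) : vpoly k u ->
  poly3 k (fun x => dot (curl u x) w).
Proof.
move=> uP.
have dP i j : poly3 k (pd i (fun y => u y 0 j)) by apply: poly3_pd; exact: uP.
rewrite [X in poly3 k X](_ : _ = fun x =>
  ((pd 1 (fun y => u y 0 2%:R) x + - pd 2%:R (fun y => u y 0 1) x) * w 0 0 +
   (pd 2%:R (fun y => u y 0 0) x + - pd 0 (fun y => u y 0 2%:R) x) * w 0 1) +
   (pd 0 (fun y => u y 0 1) x + - pd 1 (fun y => u y 0 0) x) * w 0 2%:R); last first.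
  by apply/funext => x; rewrite dotE /curl !(vec30, vec31, vec32).
by apply: poly3D; [apply: poly3D|]; apply: poly3Zr; apply: poly3D => //; exact: poly3N.
Qed.

Lemma poly3_grad_dot p (w : pt) : poly3 k p -> poly3 k (fun x => dot (grad p x) w).
Proof.
move=> pP; rewrite /dot; apply: poly3_sum => i _; apply: poly3Zr.
rewrite [X in poly3 k X](_ : _ = pd i p); first exact: poly3_pd.
by apply/funext => x; rewrite mxE.
Qed.

Lemma pd_dot (u : pt -> pt) (w : pt) x i : vpoly k u ->
  pd i (fun y => dot (u y) w) x = \sum_j pd i (fun y => u y 0 j) x * w 0 j.
Proof.
move=> uP; have du j := (poly3_derive (uP j)).1 x (delta_mx 0 i).
rewrite [in LHS]/pd.
have E : (fun y => dot (u y) w) = (\sum_j (w 0 j \*: ((fun y => u y 0 j) : pt -> R^o))).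
  apply/funext => y; rewrite /dot fct_sumE; apply: eq_bigr => j _.
  by rewrite mulrC.
rewrite E.
have dZ j := is_deriveZ (w 0 j) (du j).
have [_ ->] := is_derive_sum dZ.
apply: eq_bigr => j _; rewrite mulrC; congr (_ * _).
by have [_ <-] := du j.
Qed.

(** The left-hand side is the surface divergence of u x n. By [orthonormal3_cross] it is the sum
    over i of the i-th partial derivative of u dotted with n x e_i, where the frame no longer
    appears. *)
Lemma curl_dot (u : pt -> pt) (n t1 t2 x : pt) : orthonormal3 n t1 t2 -> vpoly k u ->
  dot (grad (fun y => dot (cross (u y) n) t1) x) t1 +
  dot (grad (fun y => dot (cross (u y) n) t2) x) t2 = dot (curl u x) n.
Proof.
move=> o3 uP.
have gE t : dot (grad (fun y => dot (cross (u y) n) t) x) t =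
    \sum_i \sum_j pd i (fun y => u y 0 j) x * (t 0 i * cross n t 0 j).
  rewrite /dot; apply: eq_bigr => i _; rewrite mxE.
  rewrite (_ : (fun y => _) = (fun y => dot (u y) (cross n t))); last first.
    by apply/funext => y; rewrite -dot_crossl.
  by rewrite pd_dot// mulr_suml; apply: eq_bigr => j _; ring.
rewrite !gE -big_split/=.
transitivity (\sum_(i < 3) \sum_(j < 3) pd i (fun y => u y 0 j) x *
    cross n (delta_mx 0 i) 0 j).
  apply: eq_bigr => i _; rewrite -big_split/=; apply: eq_bigr => j _.
  rewrite -(orthonormal3_cross i o3) [in RHS]mxE [in X in _ * (X + _)]mxE.
  by rewrite [in X in _ * (_ + X)]mxE mulrDr.
rewrite dotE /curl !(vec30, vec31, vec32).
have sum3 (F : 'I_3 -> R) : \sum_i F i = F 0 + F 1 + F 2%:R.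
  rewrite !big_ord_recl big_ord0 addr0 addrA.
  by congr (_ + _ + _); congr (F _); apply/val_inj.
rewrite !sum3 /cross !(vec30, vec31, vec32) !mxE /=.
ring.
Qed.

End Poly.
End VectorCalculus.

Section Commutation.
Context {R : realType} (P : polyhedron R) (k : nat).
Local Notation pt := 'rV[R]_3.
Variable v : pt -> R.
Hypothesis vC1 : C1 (region P) v.

Let G := gradient (region P) v.

Let GP x : region P x -> has_gradient (region P) v x (G x).
Proof.
move=> Dx; rewrite /G /gradient; case: xgetP => [g _ //|noG].
by have [g /noG] := vC1.1 x Dx.
Qed.

Let cv : {within region P, continuous v}.
Proof. exact: (has_gradient_continuous vC1.1). Qed.

Let cG i : {within region P, continuous (fun x => G x 0 i)}.
Proof.
move=> x; apply: (@continuous_comp _ _ _ (G : subspace (region P) -> pt)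
  (fun u : pt => u 0 i)); first exact: vC1.2.
exact: continuous_coord.
Qed.

Let cGdot (w : pt) : {within region P, continuous (fun x => dot (G x) w)}.
Proof.
apply: within_continuous_sum => i _; apply: within_continuousM; first exact: cG.
exact: within_continuous_cst.
Qed.

Let cpoly (D : set pt) p : poly3 k p -> {within D, continuous p}.
Proof. by move=> /poly3_continuous cp; exact: continuous_subspaceT. Qed.

Let line_derive (x e : pt) (s : R) (p : pt -> R) : poly3 k p ->
  region P (x + s *: e) -> (\forall t \near s, region P (x + t *: e)) ->
  is_derive s 1 ((fun t => v (x + t *: e) * p (x + t *: e)) : R -> R^o)
    (dot (G (x + s *: e)) e * p (x + s *: e) +
     v (x + s *: e) * dot (grad p (x + s *: e)) e).
Proof.
move=> pP Ds Dt.
have dv := has_gradient_line (GP Ds) Ds Dt.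
have dp := is_derive_line x e s pP.
have dvp := is_deriveM dv dp.
apply: (@is_derive_eq _ _ _ _ _ _ _ _ dvp).
by rewrite addrC; congr (_ + _); exact: mulrC.
Qed.

Let restrict (D : set pt) (u : pt -> R) : D `<=` region P ->
  {within region P, continuous u} -> {within D, continuous u}.
Proof. by move=> DP; exact: continuous_subspaceW. Qed.

Let div_dotE (phi : pt -> pt) x :
  \sum_(i < 3) dot (grad (fun y => phi y 0 i) x) (delta_mx 0 i) = div phi x.
Proof. by apply: eq_bigr => i _; rewrite dot_delta mxE. Qed.

(** [region_divergence] is applied to the i-th component of [v phi] in the i-th direction; summed
    over i, the product rule gives both volume terms. *)
Lemma volume_green (phi : pt -> pt) : vpoly k phi ->
  int_vol (region P) (fun x => dot (G x) (phi x)) =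
  - int_vol (region P) (fun x => v x * div phi x)
  + \sum_(f : face P) int_face f (fun x => v x * dot (phi x) (fout f)).
Proof.
move=> phiP.
have ivol := integral_on_vol P.
pose g (i : 'I_3) x := dot (G x) (delta_mx 0 i) * phi x 0 i +
  v x * dot (grad (fun y => phi y 0 i) x) (delta_mx 0 i).
have cg i : {within region P, continuous (g i)}.
  apply: within_continuousD; apply: within_continuousM.
  - exact: cGdot.
  - by apply: cpoly; exact: phiP.
  - exact: cv.
  - by apply: cpoly; apply: poly3_grad_dot; exact: phiP.
have gE i : int_vol (region P) (g i) =
    \sum_(f : face P) int_face f (fun x => v x * phi x 0 i * fout f 0 i).
  apply: (@region_divergence R P i (fun x => v x * phi x 0 i) (g i)) => //.
    by apply: within_continuousM => //; apply: cpoly; exact: phiP.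
  move=> x s Ds; apply: line_derive; first exact: phiP.
    exact: interior_subset Ds.
  have := @line_interior R 0 x (delta_mx 0 i) (region P) s.
  by rewrite dot0l relint0; apply.
have sumg : int_vol (region P) (fun x => dot (G x) (phi x)) +
    int_vol (region P) (fun x => v x * div phi x) = \sum_i int_vol (region P) (g i).
  rewrite -(integral_onD ivol); last 2 first.
  - apply: within_continuous_sum => i _; apply: within_continuousM; first exact: cG.
    by apply: cpoly; exact: phiP.
  - by apply: within_continuousM => //; apply: cpoly; exact: poly3_div.
  rewrite -(integral_on_sum ivol cg); congr (int_vol _ _); apply/funext => x.
  rewrite /g big_split/= -mulr_sumr div_dotE; congr (_ + _).
  by apply: eq_bigr => i _; rewrite dot_delta.
rewrite (eq_bigr _ (fun i _ => gE i)) exchange_big /= in sumg.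
apply: (@addIr _ (int_vol (region P) (fun x => v x * div phi x))).
rewrite sumg addrAC addNr add0r; apply: eq_bigr => f _.
rewrite -(integral_on_sum (integral_on_face f)) => [|i].
  congr (int_face _ _); apply/funext => x; rewrite /dot mulr_sumr.
  by apply: eq_bigr => i _; rewrite mulrA.
apply: restrict; first exact: fset_region.
apply: within_continuousM; last exact: within_continuous_cst.
by apply: within_continuousM => //; apply: cpoly; exact: phiP.
Qed.

Lemma fpoly_vpoly (f : face P) (theta : pt -> pt) : fpoly k f theta -> vpoly k theta.
Proof.
move=> [p1 [p2 [p1P p2P ->]]] i.
rewrite [X in poly3 k X](_ : _ = fun x => p1 x * ftan1 f 0 i + p2 x * ftan2 f 0 i).
  by apply: poly3D; exact: poly3Zr.
by apply/funext => x; rewrite !mxE.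
Qed.

(** [curl_dot] evaluates the divergence of theta x n. Its flux through an edge with conormal c is
    (theta x n) . c = theta . (n x c), and n x c is [btan f e]. *)
Lemma face_green (f : face P) (theta : pt -> pt) : fpoly k f theta ->
  int_face f (fun x => dot (G x) (cross (theta x) (fnormal f))) =
  - int_face f (fun x => v x * dot (curl theta x) (fnormal f))
  + \sum_(e in fedges f) int_edge e (fun x => v x * dot (theta x) (btan f e)).
Proof.
move=> /fpoly_vpoly thetaP.
have fo := face_orthonormal f.
have iface := integral_on_face f.
have restr (u : pt -> R) : {within region P, continuous u} ->
    {within fset f, continuous u} by apply: restrict; exact: fset_region.
pose a t x := dot (cross (theta x) (fnormal f)) t.
have aP t : poly3 k (a t).
  rewrite [X in poly3 k X](_ : _ = fun x => dot (theta x) (cross (fnormal f) t)).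
    exact: poly3_dot.
  by apply/funext => x; rewrite /a dot_crossl.
pose g t x := dot (G x) t * a t x + v x * dot (grad (a t) x) t.
have cg t : {within region P, continuous (g t)}.
  apply: within_continuousD; apply: within_continuousM => //.
  - by apply: cpoly; exact: aP.
  - by apply: cpoly; apply: poly3_grad_dot; exact: aP.
have gE t t' : (t = ftan2 f /\ t' = ftan1 f) \/ (t = ftan1 f /\ t' = ftan2 f) ->
    int_face f (g t) =
    \sum_(e in fedges f) int_edge e (fun x => v x * a t x * dot (conormal f e) t).
  move=> tt'; have nt : dot (fnormal f) t = 0.
    by have [_ [n1 n2 _]] := fo; case: tt' => -[-> _].
  apply: (@face_divergence R P f t t' tt' (fun x => v x * a t x) (g t)).
  - by apply: restr; apply: within_continuousM => //; apply: cpoly; exact: aP.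
  - exact: restr.
  - move=> x s rs; have fxs := line_interior nt rs.
    apply: line_derive => //.
      by apply: fset_region; exact: (interior_subset fxs).
    by apply: filterS fxs => r; exact: fset_region.
have E1 := gE (ftan1 f) (ftan2 f) (or_intror (conj erefl erefl)).
have E2 := gE (ftan2 f) (ftan1 f) (or_introl (conj erefl erefl)).
have sumg : int_face f (fun x => dot (G x) (cross (theta x) (fnormal f))) +
    int_face f (fun x => v x * dot (curl theta x) (fnormal f)) =
    int_face f (g (ftan1 f)) + int_face f (g (ftan2 f)).
  rewrite -!(integral_onD iface); try exact: restr.
  - congr (int_face _ _); apply/funext => x.
    rewrite (orthonormal3_dot (G x) _ fo) dot_cross_self mulr0 add0r.
    rewrite -(curl_dot x fo thetaP) /g /a.
    rewrite (dotC (ftan1 f) (G x)) (dotC (ftan2 f) (G x)).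
    rewrite (dotC (ftan1 f) (cross _ _)) (dotC (ftan2 f) (cross _ _)).
    by rewrite mulrDr; ring.
  - apply: restr; apply: within_continuous_sum => i _.
    apply: within_continuousM; first exact: cG.
    rewrite (_ : (fun x => _) = a (delta_mx 0 i)); first exact: cpoly.
    by apply/funext => x; rewrite /a dot_delta.
  - apply: restr; apply: within_continuousM => //.
    by apply: cpoly; exact: poly3_curl.
rewrite E1 E2 -big_split/= in sumg.
apply: (@addIr _ (int_face f (fun x => v x * dot (curl theta x) (fnormal f)))).
rewrite sumg addrAC addNr add0r; apply: eq_bigr => e ef.
have restre (u : pt -> R) : {within region P, continuous u} ->
    {within eset e, continuous u} by apply: restrict; exact: eset_region.
rewrite -(integral_onD (integral_on_edge e)).
- congr (int_edge _ _); apply/funext => x.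
  rewrite /btan -dot_crossl (orthonormal3_dot (cross _ _) _ fo).
  rewrite dot_cross_self mul0r add0r /a.
  rewrite (dotC (ftan1 f) (cross _ _)) (dotC (ftan2 f) (cross _ _)).
  by rewrite (dotC (ftan1 f)) (dotC (ftan2 f)); ring.
- apply: restre; apply: within_continuousM; last exact: within_continuous_cst.
  by apply: within_continuousM => //; apply: cpoly; exact: aP.
- apply: restre; apply: within_continuousM; last exact: within_continuous_cst.
  by apply: within_continuousM => //; apply: cpoly; exact: aP.
Qed.

Lemma edge_green (e : edge P) (phi : pt -> R) : poly3 k phi ->
  int_edge e (fun x => dot (G x) (etan e) * phi x) =
  - int_edge e (fun x => v x * dot (grad phi x) (etan e))
  + (v (vpos (etgt e)) * phi (vpos (etgt e)) - v (vpos (esrc e)) * phi (vpos (esrc e))).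
Proof.
move=> phiP; have e0 := elen_gt0 e.
have restre (u : pt -> R) : {within region P, continuous u} ->
    {within eset e, continuous u} by apply: restrict; exact: eset_region.
pose g x := dot (G x) (etan e) * phi x + v x * dot (grad phi x) (etan e).
pose h x := v x * phi x.
have ch : {within region P, continuous h}.
  by apply: within_continuousM => //; exact: cpoly.
have c1 : {within region P, continuous (fun x => dot (G x) (etan e) * phi x)}.
  by apply: within_continuousM => //; exact: cpoly.
have c2 : {within region P, continuous (fun x => v x * dot (grad phi x) (etan e))}.
  by apply: within_continuousM => //; apply: cpoly; exact: poly3_grad_dot.
have cg : {within region P, continuous g} by exact: within_continuousD.
have cpath (u : pt -> R) : {within region P, continuous u} ->
    {within `[0, elen e], continuous (u \o epath e)}.
  move=> cu; apply: (within_continuous_comp (@continuous_epath R P e) _ cu) => s.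
  by rewrite /= in_itv/= => s01; apply/eset_region/epath_eset.
have FTC : \int[leb1 R]_(s in `[0, elen e]) g (epath e s) =
    h (epath e (elen e)) - h (epath e 0).
  have [_ h0 h1] := (continuous_within_itvP (h \o epath e) e0).1 (cpath h ch).
  have dh s : s \in `]0, elen e[ ->
      is_derive s 1 ((h \o epath e) : R -> R^o) (g (epath e s)).
    move=> s01; apply: line_derive => //.
      by apply/eset_region/epath_eset; move: s01; rewrite in_itv/= => /andP[/ltW -> /ltW ->].
    have : \forall t \near s, t \in `]0, elen e[ by exact: near_in_itvoo.
    apply: filterS => t t01; apply/eset_region/epath_eset.
    by move: t01; rewrite in_itv/= => /andP[/ltW -> /ltW ->].
  rewrite /Rintegral (@continuous_FTC2 R (g \o epath e) (h \o epath e) 0 (elen e))//.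
  - exact: cpath.
  - by split => // s /dh[].
  - by move=> s s01; rewrite derive1E; have [_ ->] := dh s s01.
have -> : vpos (etgt e) = epath e (elen e).
  by rewrite /epath -edge_vecE addrC subrK.
have -> : vpos (esrc e) = epath e 0 by rewrite /epath scale0r addr0.
rewrite -/(h _) -/(h (epath e 0)) -FTC.
have -> : \int[leb1 R]_(s in `[0, elen e]) g (epath e s) = int_edge e g by [].
rewrite (integral_onD (integral_on_edge e)); [|exact: restre|exact: restre].
by rewrite addrC addrK.
Qed.

(** * Equivalence of the defining conditions *)

Lemma vol_eq (w : pt -> pt) :
  weak_grad_vol_eq k (Qh1 P k v) w <->
  (forall phi, vpoly k phi -> int_vol (region P) (fun x => dot (w x) (phi x)) =
     int_vol (region P) (fun x => dot (G x) (phi x))).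
Proof.
have E phi : vpoly k phi ->
    - int_vol (region P) (fun x => c1_vol (Qh1 P k v) x * div phi x)
    + \sum_(f : face P)
        int_face f (fun x => c1_face (Qh1 P k v) f x * dot (phi x) (fout f)) =
    int_vol (region P) (fun x => dot (G x) (phi x)).
  move=> phiP; rewrite volume_green//; congr (- _ + _).
    exact: (proj_poly3E (integral_on_vol P) cv (poly3_div phiP)).
  apply: eq_bigr => f _.
  apply: (proj_poly3E (integral_on_face f) _ (poly3_dot (fout f) phiP)).
  by apply: restrict => //; exact: fset_region.
by split => H phi phiP; rewrite H// E.
Qed.

(** The weak gradient is tested with theta x n and the projection with arbitrary tangential fields.
    Crossing with n is a quarter turn of the tangent plane that preserves [fpoly], so both families
    of tests coincide. The double cross product is the tangential part of the gradient and pairs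
    with tangential fields as the gradient does. *)
Lemma face_eq (f : face P) (w : pt -> pt) :
  weak_grad_face_eq k (Qh1 P k v) f w <->
  (forall phi, fpoly k f phi -> int_face f (fun x => dot (w x) (phi x)) =
     int_face f (fun x =>
       dot (cross (fnormal f) (cross (G x) (fnormal f))) (phi x))).
Proof.
have fo := face_orthonormal f; have [[nn _ _] [n1 n2 _]] := fo.
have fn (phi : pt -> pt) x : fpoly k f phi -> dot (fnormal f) (phi x) = 0.
  by move=> [p1 [p2 [_ _ ->]]]; rewrite dotDr !dotZr n1 n2 !mulr0 addr0.
have E theta : fpoly k f theta ->
    - int_face f (fun x => c1_face (Qh1 P k v) f x * dot (curl theta x) (fnormal f))
    + \sum_(e in fedges f)
        int_edge e (fun x => c1_edge (Qh1 P k v) e x * dot (theta x) (btan f e)) =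
    int_face f (fun x => dot (cross (fnormal f) (cross (G x) (fnormal f)))
      (cross (theta x) (fnormal f))).
  move=> thetaP; have vP := fpoly_vpoly thetaP.
  have -> : (fun x => dot (cross (fnormal f) (cross (G x) (fnormal f)))
      (cross (theta x) (fnormal f))) =
      (fun x => dot (G x) (cross (theta x) (fnormal f))).
    by apply/funext => x; rewrite dot_cross_cross// dot_cross_self.
  rewrite face_green//; congr (- _ + _).
    apply: (proj_poly3E (integral_on_face f) _ (poly3_curl (fnormal f) vP)).
    by apply: restrict => //; exact: fset_region.
  apply: eq_bigr => e ef.
  apply: (proj_poly3E (integral_on_edge e) _ (poly3_dot (btan f e) vP)).
  by apply: restrict => //; exact: eset_region.
have crossP (phi : pt -> pt) : fpoly k f phi ->
    fpoly k f (fun x => cross (phi x) (fnormal f)).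
  move=> phiP; have vP := fpoly_vpoly phiP.
  exists (fun x => dot (phi x) (cross (fnormal f) (ftan1 f))).
  exists (fun x => dot (phi x) (cross (fnormal f) (ftan2 f))).
  split; [exact: poly3_dot|exact: poly3_dot|].
  apply/funext => x; rewrite {1}(orthonormal3_expand (cross (phi x) (fnormal f)) fo).
  by rewrite dot_cross_self scale0r add0r !(dotC _ (cross (phi x) _)) !dot_crossl.
split => H phi phiP; last by rewrite (H _ (crossP phi phiP)) E.
(* Three quarter turns of [phi]; the fourth, made in the test term, restores [phi]. *)
pose theta x := cross (cross (cross (phi x) (fnormal f)) (fnormal f)) (fnormal f).
have thetaP : fpoly k f theta by exact: (crossP _ (crossP _ (crossP _ phiP))).
have <- : (fun x => cross (theta x) (fnormal f)) = phi.
  by apply/funext => x; apply: cross_iter4 => //; exact: fn.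
by rewrite H// E.
Qed.

Lemma edge_eq (e : edge P) (w : pt -> pt) :
  weak_grad_edge_eq k (Qh1 P k v) e w <->
  (forall phi, epoly k e phi -> int_edge e (fun x => dot (w x) (phi x)) =
     int_edge e (fun x => dot (dot (G x) (etan e) *: etan e) (phi x))).
Proof.
have tt := etan_unit e.
have E phi : poly3 k phi ->
    - int_edge e (fun x => c1_edge (Qh1 P k v) e x * dot (grad phi x) (etan e))
    + (c1_vertex (Qh1 P k v) (etgt e) *
         dot (phi (vpos (etgt e)) *: etan e) (etan e)
       + c1_vertex (Qh1 P k v) (esrc e) *
         dot (phi (vpos (esrc e)) *: etan e) (- etan e)) =
    int_edge e (fun x => dot (dot (G x) (etan e) *: etan e) (phi x *: etan e)).
  move=> phiP.
  have -> : (fun x => dot (dot (G x) (etan e) *: etan e) (phi x *: etan e)) =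
      (fun x => dot (G x) (etan e) * phi x).
    by apply/funext => x; rewrite (dotZl (dot _ _)) (dotZr (phi x)) tt mulr1.
  rewrite edge_green//; congr (- _ + _).
    apply: (proj_poly3E (integral_on_edge e) _ (poly3_grad_dot (etan e) phiP)).
    by apply: restrict => //; exact: eset_region.
  rewrite (dotZl (phi _)) tt mulr1 (dotZl (phi _)) dotNr tt /=; ring.
split => [H _ [phi phiP <-]|H phi phiP]; first by rewrite H// E.
by rewrite (H (fun x => phi x *: etan e))//; [rewrite E|exists phi].
Qed.

End Commutation.

Theorem lemma4p1 (R : realType) (P : polyhedron R) (k : nat)
  (v : 'rV[R]_3 -> R) :
  H1 (region P) v -> C1 (region P) v ->
  weak_grad k (Qh1 P k v) = Qh2 P k (gradient (region P) v).
Proof.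
move=> _ vC1; rewrite /weak_grad /Qh2 /vproj; congr Composite2.
- congr get; apply/seteqP.
  by split => w [wP H]; split => //; apply/(vol_eq k vC1).
- apply/funext => f; congr get; apply/seteqP.
  by split => w [wP H]; split => //; apply/(face_eq k vC1).
- apply/funext => e; congr get; apply/seteqP.
  by split => w [wP H]; split => //; apply/(edge_eq k vC1).
Qed.
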